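(* Let $\beta\in(0,1)$, $x_0\in\mathbb{R}$, $p>\frac1\beta$ and $q=\frac{p}{p-1}$. If $f:(0,+\infty)\times\mathbb{R}\to\mathbb{R}$ is a continuous function and $$|f(t,x)-f(t,y)|\le l(t)|x-y|$$ for all $x,y\in\mathbb{R}$ and $t\in(0,+\infty)$, where $l\in C(0,+\infty)\cap L^{p}_{Loc}[0,+\infty)$ and $t^{1-\beta}|f(t,0)|\in L^{p}_{Loc}[0,+\infty)$, then the fractional differential equation $$D_{r}^{\beta}x(t)=f(t,x(t)),\qquad \lim_{t\to0^{+}}t^{1-\beta}x(t)=x_{0},$$ has a unique solution on $(0,+\infty)$.
   Context: $L^{p}_{Loc}[0,+\infty)$ denotes the functions belonging to $L^p[0,T]$ for every $T>0$. For $\alpha\in(0,1)$, $C_{\alpha}(0,+\infty)$ is the set of $x\in C(0,+\infty)$ such that $\lim_{t\to0^{+}}t^{\alpha}x(t)$ exists (as a finite real number). For $\beta\in(0,1)$, the Riemann-Liouville fractional integral is $I^{\beta}\varphi(t)=\frac{1}{\Gamma(\beta)}\int_{0}^{t}\frac{\varphi(s)}{(t-s)^{1-\beta}}\,ds$ for $\varphi\in L^1[0,T]$, and the Riemann-Liouville fractional derivative is $D_{r}^{\beta}\varphi(t)=\frac{d}{dt}I^{1-\beta}\varphi(t)=\frac{1}{\Gamma(1-\beta)}\frac{d}{dt}\int_{0}^{t}\frac{\varphi(s)}{(t-s)^{\beta}}\,ds$ for a.e. $t\in[0,T]$, where $I^{1-\beta}\varphi$ is required to be an absolutely continuous function (i.e.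 it agrees on $(0,T]$ with an absolutely continuous function on $[0,T]$). A solution on $(0,+\infty)$ is a function $x\in C_{1-\beta}(0,+\infty)$ such that, for every $T>0$, $I^{1-\beta}x$ is absolutely continuous on $[0,T]$ in this sense and $D_r^\beta x(t)=f(t,x(t))$ for a.e. $t\in(0,T]$, and such that $\lim_{t\to0^+}t^{1-\beta}x(t)=x_0$. *)

(* Defs.v *)
From mathcomp Require Export all_boot all_order all_algebra.
From mathcomp Require Export all_classical all_reals all_analysis.

Set Implicit Arguments.
Unset Strict Implicit.
Unset Printing Implicit Defensive.

Export Order.TTheory GRing.Theory Num.Theory.
Export numFieldNormedType.Exports.

Local Open Scope classical_set_scope.
Local Open Scope ring_scope.

(* Throughout, a function on (0, +oo) is represented by a total function on R
   whose values outside (0, +oo) are irrelevant. *)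

(* The value at the endpoint 0 of [0, T] does not matter, as {0} is null. *)
Definition Lp_loc (R : realType) (p : R) (g : R -> R) : Prop :=
  forall T : R, 0 < T ->
    (g \_ `[0, T] : R -> R) \in Lfun (@lebesgue_measure R) p%:E.

Definition weightedC (R : realType) (alpha : R) (x : R -> R) : Prop :=
  {within `]0, +oo[, continuous x} /\
  exists c : R, t `^ alpha * x t @[t --> 0^'+] --> c.

Definition Gamma (R : realType) (a : R) : R :=
  \int[@lebesgue_measure R]_(t in `]0, +oo[) (t `^ (a - 1) * expR (- t)).

(* For b < 1 the integrand is 0 at s = t, since 0 `^ (1 - b) = 0 and 0^-1 = 0. *)
Definition RL_integral (R : realType) (b : R) (phi : R -> R) (t : R) : R :=
  (Gamma b)^-1 *
  \int[@lebesgue_measure R]_(s in `[0, t]) (phi s / (t - s) `^ (1 - b)).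

Definition RL_derivative (R : realType) (b : R) (phi : R -> R) : R -> R :=
  derive1 (RL_integral (1 - b) phi).

Definition absolutely_continuous (R : realType) (a b : R) (F : R -> R) : Prop :=
  forall e : R, 0 < e -> exists2 d : R, 0 < d &
    forall (n : nat) (u v : 'I_n -> R),
      (forall i, [/\ a <= u i, u i < v i & v i <= b]) ->
      trivIset setT (fun i => `]u i, v i[%classic) ->
      \sum_(i < n) (v i - u i) < d ->
      \sum_(i < n) `|F (v i) - F (u i)| < e.

(* The value of F at 0 is disregarded: the total function RL_integral takes
   the value 0 there, whereas the continuous extension need not. *)
Definition AC_extends (R : realType) (T : R) (F : R -> R) : Prop :=
  exists2 G : R -> R, absolutely_continuous 0 T G &
    forall t : R, 0 < t <= T -> F t = G t.

(* derive1 is a total operator, so differentiability is required separately. *)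
Definition is_solution (R : realType) (b x0 : R) (f : R -> R -> R)
    (x : R -> R) : Prop :=
  [/\ weightedC (1 - b) x,
      forall T : R, 0 < T -> AC_extends T (RL_integral (1 - b) x),
      forall T : R, 0 < T ->
        {ae @lebesgue_measure R, forall t : R, 0 < t <= T ->
          derivable (RL_integral (1 - b) x) t 1 /\
          RL_derivative b x t = f t (x t)}
    & t `^ (1 - b) * x t @[t --> 0^'+] --> x0].

(* Main.v *)
Require Import Defs.
From mathcomp Require Import all_boot all_order all_algebra.
From mathcomp Require Import all_classical all_reals all_analysis.
From mathcomp Require Import measurable_realfun ring lra.

(** With z = t^(1-b) x(t), the problem is equivalent to the Volterra equation
      x(t) = x0 t^(b-1) + c \int_0^t (t-s)^(b-1) f(s, x(s)) ds,
    where c = Gamma(1-b) / B(b, 1-b).  From the Volterra equation, Fubini and the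
    Beta integral give I^(1-b) x = const + \int_0^t f(s, x(s)) ds.  Conversely, for a
    solution the difference of these two sides is absolutely continuous with zero
    derivative a.e., hence constant (a Cousin covering argument); letting t -> 0
    fixes the constant, and one more Abel integration removes I^(1-b).

    The Volterra operator is a contraction for the norm
    sup_{0 < t <= T} |x(t)| t^(1-b) e^(-lam t) when lam is large.  Fix a with
    1/p < a < b.  Since (t / (s (t-s)))^(1-b) is at most 2 s^(b-1) or 2 (t-s)^(b-1)
    and u^(b-a) e^(-lam u) <= lam^(a-b), everything reduces to the integrals of
    s^(a-1) l(s) and (t-s)^(a-1) l(s), which Young's inequality bounds
    uniformly in t because a > 1/p. *)

Import Order.TTheory GRing.Theory Num.Theory.
Import numFieldNormedType.Exports.

Set Implicit Arguments.
Unset Strict Implicit.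
Unset Printing Implicit Defensive.

Local Open Scope classical_set_scope.
Local Open Scope ring_scope.

(** * The Abel kernel and the Beta integral *)

(** A solution may blow up like s^(b-1) at 0 and the weights are only in L^p, so the source
    [f s (x s)] has no local bound near 0 and the estimates must be integral bounds uniform in [t].
    The gap [b - a] is spent twice: it gives the decay in [lam], and it makes the Abel term
    negligible against t^(b-1) at 0. The iteration can therefore run in the class [wcont], which
    asks for a local bound on t^(1-b) x(t) but not for its limit; fixed points recover the limit
    afterwards.

    For uniqueness the obstacle is the endpoint 0: the absolutely continuous extension of I^(1-b) y
    need not agree with the value of [RL_integral] there, so the initial condition cannot be read
    off at 0. A solution [y] is compared instead with its own image [picard y]. Both have the
    weighted limit [x0], so the Abel integral of their difference, which is constant, also tends to
    0. *)

Section Kernel.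
Context {R : realType}.
Local Notation mu := (@lebesgue_measure R).
Implicit Types (a b s t u T : R) (g h : R -> R).

(* u_+^(a-1): extending the kernel by 0 lets every integral run over the whole line. *)
Definition kern a u : R := if 0 < u then u `^ (a - 1) else 0.

Lemma kern_ge0 a u : 0 <= kern a u.
Proof. by rewrite /kern; case: ifP => // _; exact: powR_ge0. Qed.

Lemma kern_pos a u : 0 < u -> kern a u = u `^ (a - 1).
Proof. by rewrite /kern => ->. Qed.

Lemma kern_npos a u : u <= 0 -> kern a u = 0.
Proof. by rewrite /kern ltNge => ->. Qed.

Lemma measurable_kern a : measurable_fun [set: R] (kern a).
Proof.
by apply: measurable_fun_ifT => //; exact: measurable_fun_ltr.
Qed.

Lemma measurable_kern_refl a t : measurable_fun [set: R] (fun s => kern a (t - s)).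
Proof.
apply: (measurableT_comp (measurable_kern a)).
exact: measurable_funB.
Qed.

(** The kernel may blow up at 0, so the fundamental theorem of calculus is applied on
    [[1/(n+1), T]], where it is continuous. Monotone convergence along these intervals carries the
    bound over. *)
Lemma integral_kern_le a T : 0 < a -> 0 < T ->
  (\int[mu]_(u in `]0%R, T]) (kern a u)%:E <= (T `^ a / a)%:E)%E.
Proof.
move=> a0 T0.
pose F (n : nat) := `[(n.+1%:R^-1 : R), T]%classic.
have ndF : nondecreasing_seq F.
  apply/nondecreasing_seqP => n; rewrite subsetEset /F => x /=.
  rewrite !in_itv/= => /andP[nx ->]; rewrite andbT (le_trans _ nx)//.
  by rewrite lef_pV2 ?posrE// ler_nat.
have mk (A : set R) : measurable_fun A (EFin \o kern a).
  by apply/measurable_EFinP; apply: measurable_funTS; exact: measurable_kern.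
have Fpos n x : F n x -> 0 < x.
  by rewrite /F/= in_itv/= => /andP[+ _]; apply: lt_le_trans; rewrite invr_gt0.
have -> : `]0%R, T]%classic = \bigcup_n F n.
  apply/seteqP; split => [x /=|x [n _ Fnx]]; last first.
    by rewrite /= in_itv/= (Fpos _ _ Fnx)/=; move: Fnx; rewrite /F/= in_itv/= => /andP[].
  rewrite in_itv/= => /andP[x0 xT]; exists (Num.truncn x^-1) => //.
  rewrite /F /= in_itv/= xT andbT -[leRHS]invrK lef_pV2 ?posrE ?invr_gt0//.
  by rewrite ltW// truncnS_gt.
have cv : (\int[mu]_(x in F n) (kern a x)%:E @[n --> \oo] -->
    \int[mu]_(x in \bigcup_n F n) (kern a x)%:E)%E.
  apply: ge0_nondecreasing_set_cvg_integral => //.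
  - by move=> n; exact: measurable_itv.
  - by move=> n; exact: mk.
  - by move=> n x _; rewrite lee_fin kern_ge0.
rewrite -(cvg_lim _ cv)//; apply: lime_le; first by apply/cvg_ex; eexists; exact: cv.
apply: nearW => n /=; rewrite /F.
have [nT|Tn] := ltP (n.+1%:R^-1 : R) T; last first.
  move: Tn; rewrite le_eqVlt => /predU1P[->|Tn].
    by rewrite set_itv1 integral_set1 lee_fin divr_ge0 ?powR_ge0// ltW.
  by rewrite set_itv_ge ?integral_set0 ?lee_fin ?divr_ge0 ?powR_ge0 ?ltW// bnd_simp -ltNge.
have n0 : 0 < (n.+1%:R^-1 : R) by rewrite invr_gt0.
have cpow c : 0 < c -> {for c, continuous (fun x : R => x `^ a / a)}.
  move=> c0; apply: continuousM; last exact: cst_continuous.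
  apply: differentiable_continuous.
  by apply/derivable1_diffP; apply: derivable_powR; rewrite in_itv/= c0.
rewrite -/(F n).
have -> : (\int[mu]_(u in F n) (kern a u)%:E =
    \int[mu]_(u in F n) (u `^ (a - 1))%:E)%E.
  by apply: eq_integral => x; rewrite inE => Fx; rewrite kern_pos// (Fpos n).
have -> : (\int[mu]_(u in F n) (u `^ (a - 1))%:E =
    (T `^ a / a)%:E - ((n.+1%:R^-1)%R `^ a / a)%:E)%E; last first.
  by rewrite -EFinB lee_fin gerBl divr_ge0 ?powR_ge0 ?ltW.
apply: (@continuous_FTC2 _ (fun x => x `^ (a - 1)) (fun x => x `^ a / a)) => //.
- apply: derivable_within_continuous => x; rewrite in_itv/= => /andP[nx _].
  by apply: derivable_powR; rewrite in_itv/= (lt_le_trans n0 nx).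
- split.
  + move=> x; rewrite in_itv/= => /andP[nx _].
    apply: derivableM => //; apply: derivable_powR; rewrite in_itv/= andbT.
    exact: lt_trans nx.
  + by apply: cvg_at_right_filter; exact: cpow.
  + by apply: cvg_at_left_filter; exact: cpow.
- move=> x; rewrite in_itv/= => /andP[nx _]; rewrite derive1Mr; last first.
    by apply: derivable_powR; rewrite in_itv/= andbT (lt_trans n0 nx).
  rewrite powR_derive1 ?in_itv/= ?andbT ?(lt_trans n0 nx)//.
  by rewrite mulrAC divff ?mul1r ?gt_eqF.
Qed.
End Kernel.

(** * Affine substitutions, the truncated kernel and the Beta integral *)

Section ChangeOfVariables.
Context {R : realType}.
Local Notation mu := (@lebesgue_measure R).

(** Lebesgue measure is determined by its values on half-open intervals, and [r] times its
    pushforward under u -> c + r u has the same values there. Integrating against that pushforward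
    is the substitution. *)
Lemma ge0_integral_scale_translate (r c : R) (f : R -> \bar R) : 0 < r ->
  measurable_fun [set: R] f -> (forall u, 0 <= f u)%E ->
  (\int[mu]_u f u = r%:E * \int[mu]_u f (c + r * u)%R)%E.
Proof.
move=> r0 mf f0.
pose phi : measurableTypeR R -> measurableTypeR R := fun u => c + r * u.
have mphi : measurable_fun [set: measurableTypeR R] phi.
  apply: measurable_funD => //; exact: measurable_funM.
pose m : {measure set (measurableTypeR R) -> \bar R} :=
  mscale (NngNum (ltW r0)) (measure_function_pushforward__canonical__measure_function_Measure mu mphi).
have mE A : measurable A -> mu A = m A.
  apply: lebesgue_measure_unique => _ [[a b]] _ <-.
  rewrite /m /= /mscale /= /pushforward.
  have -> : phi @^-1` `]a, b]%classic = `](a - c) / r, (b - c) / r]%classic.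
    apply/seteqP; split => u /=; rewrite !in_itv/= /phi.
      by rewrite ltr_pdivrMr// ler_pdivlMr// ltrBlDl lerBrDl (mulrC u).
    by rewrite ltr_pdivrMr// ler_pdivlMr// ltrBlDl lerBrDl (mulrC u).
  rewrite !lebesgue_measure_itv/= !lte_fin ltr_pM2r ?invr_gt0// ltrD2r.
  case: ifPn => _; last by rewrite mule0.
  by rewrite -!EFinB -EFinM; congr EFin; field; rewrite gt_eqF.
rewrite (eq_measure_integral m); last by move=> A mA _; exact: mE.
rewrite ge0_integral_mscale//; congr (_ * _)%E.
by rewrite ge0_integral_pushforward.
Qed.

Lemma ge0_integral_reflect (t : R) (f : R -> \bar R) :
  measurable_fun [set: R] f -> (forall u, 0 <= f u)%E ->
  (\int[mu]_u f u = \int[mu]_u f (t - u)%R)%E.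
Proof.
move=> mf f0.
rewrite (ge0_integral_scale_translate t ltr01 mf f0) mul1e.
under eq_integral do rewrite mul1r.
have mft : measurable_fun [set: R] (fun u => f (t + u)).
  by apply: (measurableT_comp mf); exact: measurable_funD.
transitivity (\int[pushforward mu (-%R : _ -> measurableTypeR R)]_u f (t + u)%R)%E.
  by apply: eq_measure_integral => A mA _; exact/esym/lebesgue_measureN.
by rewrite ge0_integral_pushforward.
Qed.


(** Truncation at [T] makes the kernel integrable over the whole line, so that it can be reflected
    with no domain to track; arguments up to [T] do not notice it. *)
Definition kcut (a T : R) := kern a \_ `]0, T].

Lemma kcut_ge0 a T u : 0 <= kcut a T u.
Proof. by rewrite /kcut patchE; case: ifP => // _; exact: kern_ge0. Qed.

Lemma measurable_kcut a T : measurable_fun [set: R] (kcut a T).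
Proof.
apply/(measurable_restrictT (kern a) (measurable_itv `]0, T])).
by apply: measurable_funTS; exact: measurable_kern.
Qed.

Lemma kcutE a T u : u <= T -> kcut a T u = kern a u.
Proof.
move=> uT; rewrite /kcut patchE; case: ifPn => //.
rewrite notin_setE/= in_itv/= uT andbT => /negP; rewrite -leNgt => u0.
by rewrite kern_npos.
Qed.

Lemma integral_kcut_le a T : 0 < a -> 0 < T ->
  (\int[mu]_u (kcut a T u)%:E <= (T `^ a / a)%:E)%E.
Proof.
move=> a0 T0; apply: le_trans (integral_kern_le a0 T0).
by rewrite [leRHS]integral_mkcond restrict_EFin.
Qed.

Lemma integral_kcut_reflect_le a T t : 0 < a -> 0 < T ->
  (\int[mu]_s (kcut a T (t - s))%:E <= (T `^ a / a)%:E)%E.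
Proof.
move=> a0 T0; rewrite -(ge0_integral_reflect t (f := EFin \o kcut a T)).
- exact: integral_kcut_le.
- by apply/measurable_EFinP; exact: measurable_kcut.
- by move=> u; rewrite lee_fin kcut_ge0.
Qed.

Lemma powR_neg_le (r x y : R) : r <= 0 -> 0 < x -> x <= y -> y `^ r <= x `^ r.
Proof.
move=> r0 x0 xy; have y0 := lt_le_trans x0 xy.
rewrite -[r]opprK !(powRN _ (- r)) lef_pV2 ?posrE ?powR_gt0//.
by apply: ge0_ler_powR => //; rewrite ?oppr_ge0// nnegrE ltW.
Qed.

(** By monotonicity the worst case is v = t/2, and (1/2)^(a-1) = 2^(1-a) is at most 2. The factor 2
    in the splitting estimates comes from here. *)
Lemma powR_half_le (a t v : R) : 0 < a < 1 -> 0 < t -> t / 2 <= v ->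
  v `^ (a - 1) <= 2 * t `^ (a - 1).
Proof.
move=> /andP[a0 a1] t0 tv.
have a10 : a - 1 <= 0 by rewrite subr_le0 ltW.
apply: (le_trans (powR_neg_le a10 _ tv)); first by rewrite divr_gt0.
rewrite (powRM _ (ltW t0)) ?invr_ge0// mulrC ler_wpM2r ?powR_ge0// -powR_inv1// -powRrM.
rewrite -[leRHS]powRr1//; apply: ler_powR; first by rewrite ler1n.
lra.
Qed.

Lemma integral_le_combination (c A B : R) (F G H : R -> R) :
  measurable_fun [set: R] F -> measurable_fun [set: R] G ->
  measurable_fun [set: R] H -> 0 <= c ->
  (forall u, 0 <= F u) -> (forall u, 0 <= G u) -> (forall u, 0 <= H u) ->
  (forall u, F u <= c * (G u + H u)) ->
  (\int[mu]_u (G u)%:E <= A%:E)%E -> (\int[mu]_u (H u)%:E <= B%:E)%E ->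
  (\int[mu]_u (F u)%:E <= (c * (A + B))%:E)%E.
Proof.
move=> mF mG mH c0 F0 G0 H0 FGH GA HB.
have -> : (c * (A + B))%:E = (c%:E * (A%:E + B%:E))%E by [].
apply: (@le_trans _ _ (\int[mu]_u (c%:E * ((G u)%:E + (H u)%:E)))%E).
  apply: ge0_le_integral => //.
  - by move=> u _; rewrite lee_fin.
  - exact/measurable_EFinP.
  - apply/measurable_funeM/emeasurable_funD; exact/measurable_EFinP.
  - by move=> u _; rewrite -EFinD -EFinM lee_fin.
rewrite ge0_integralZl//; last 2 first.
  - by apply: emeasurable_funD; exact/measurable_EFinP.
  - by move=> u _; rewrite -EFinD lee_fin addr_ge0.
rewrite lee_wpmul2l//; rewrite ge0_integralD//; first exact: leeD.
- by move=> u _; rewrite lee_fin.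
- exact/measurable_EFinP.
- by move=> u _; rewrite lee_fin.
- exact/measurable_EFinP.
Qed.

Lemma measurable_beta_integrand a d : measurable_fun [set: R]
  (fun u => kern (1 - a) (d - u) * kern a u).
Proof.
by apply: measurable_funM; [exact: measurable_kern_refl|exact: measurable_kern].
Qed.

(** On each half of []0, 1[] only one factor is near its singularity; the other is at most 2. *)
Lemma beta_integrand_le a u : 0 < a < 1 ->
  kern (1 - a) (1 - u) * kern a u <=
  2 * (kcut a 1 u + kcut (1 - a) 1 (1 - u)).
Proof.
move=> /[dup] a01 /andP[a0 a1].
have rhs0 : 0 <= 2 * (kcut a 1 u + kcut (1 - a) 1 (1 - u)).
  by rewrite mulr_ge0// addr_ge0// kcut_ge0.
have [u0|u0] := leP u 0; first by rewrite (kern_npos a u0) mulr0.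
have [u1|u1] := leP 1 u; first by rewrite (@kern_npos _ _ (1 - u)) ?mul0r// subr_le0.
have v0 : 0 < 1 - u by rewrite subr_gt0.
rewrite (kcutE _ (ltW u1)) kcutE ?gerBl ?(ltW u0)// mulrDr.
have a01' : 0 < 1 - a < 1 by apply/andP; split; lra.
have [u2|u2] := leP u (1 / 2).
  apply: ler_wpDr; first by rewrite mulr_ge0// kern_ge0.
  rewrite ler_wpM2r ?kern_ge0// kern_pos//.
  have := @powR_half_le (1 - a) 1 (1 - u) a01' ltr01; rewrite powR1 mulr1; apply; lra.
apply: ler_wpDl; first by rewrite mulr_ge0// kern_ge0.
rewrite mulrC ler_wpM2r ?kern_ge0// kern_pos//.
have := @powR_half_le a 1 u a01 ltr01; rewrite powR1 mulr1; apply; lra.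
Qed.

(** For 0 < a < 1 this is Euler's B(a, 1-a); the zero extension of the kernels confines the integral
    to []0, 1[]. *)
Definition betaI (a : R) : R := \int[mu]_u (kern (1 - a) (1 - u) * kern a u).

Lemma integrable_beta a : 0 < a < 1 ->
  mu.-integrable [set: R] (fun u => (kern (1 - a) (1 - u) * kern a u)%:E).
Proof.
move=> /[dup] a01 /andP[a0 a1]; apply/integrableP; split.
  by apply/measurable_EFinP; exact: measurable_beta_integrand.
have mk1 : measurable_fun [set: R] (fun u => kcut (1 - a) 1 (1 - u)).
  by apply: (measurableT_comp (measurable_kcut _ _)); exact: measurable_funB.
have mk0 := measurable_kcut a 1.
under eq_integral => u _ do rewrite /= ger0_norm ?mulr_ge0 ?kern_ge0//.
apply: (@le_lt_trans _ _ (2 * (1 `^ a / a + 1 `^ (1 - a) / (1 - a)))%:E); last first.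
  by rewrite ltry.
apply: (integral_le_combination (measurable_beta_integrand a 1) mk0 mk1) => //.
- by move=> u; rewrite mulr_ge0 ?kern_ge0.
- by move=> u; rewrite kcut_ge0.
- by move=> u; rewrite kcut_ge0.
- by move=> u; exact: beta_integrand_le.
- exact: integral_kcut_le.
- by apply: integral_kcut_reflect_le => //; rewrite subr_gt0.
Qed.

Lemma EFin_betaI a : 0 < a < 1 ->
  ((betaI a)%:E = \int[mu]_u (kern (1 - a) (1 - u) * kern a u)%:E)%E.
Proof.
move=> a01; rewrite /betaI /Rintegral fineK//.
exact: integrable_fin_num (integrable_beta a01).
Qed.

(** Both kernels have a negative exponent, hence are at least 1 on []0, 1[]. The bound is what
    permits division by [betaI a]. *)
Lemma betaI_ge1 a : 0 < a < 1 -> 1 <= betaI a.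
Proof.
move=> /[dup] a01 /andP[a0 a1]; rewrite -lee_fin EFin_betaI//.
apply: (@le_trans _ _ (\int[mu]_(u in `]0%R, 1%R[) (cst 1%E u))%E).
  by rewrite integral_cst//= mul1e lebesgue_measure_itv/= lte_fin ltr01 -EFinB subr0.
apply: (@le_trans _ _
    (\int[mu]_(u in `]0%R, 1%R[) (kern (1 - a) (1 - u) * kern a u)%:E)%E).
  apply: ge0_le_integral => //.
  - by apply/measurable_EFinP/measurable_funTS; exact: measurable_beta_integrand.
  - move=> u /=; rewrite in_itv/= => /andP[u0 u1].
    have k1 (c v : R) : 0 < c < 1 -> 0 < v < 1 -> 1 <= kern c v.
      move=> /andP[c0 c1] /andP[v0 v1]; rewrite kern_pos//.
      have := @powR_neg_le (c - 1) v 1; rewrite powR1; apply => //; lra.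
    by rewrite lee_fin -[leLHS]mulr1 ler_pM// k1//; apply/andP; split; lra.
apply: ge0_subset_integral => //.
- by apply/measurable_EFinP; exact: measurable_beta_integrand.
- by move=> u _; rewrite lee_fin mulr_ge0// kern_ge0.
Qed.

Lemma kern_scale (a d u : R) : 0 < d -> kern a (d * u) = d `^ (a - 1) * kern a u.
Proof.
move=> d0; have [u0|u0] := leP u 0.
  by rewrite !kern_npos ?mulr0// pmulr_rle0.
by rewrite !kern_pos ?mulr_gt0// powRM// ltW.
Qed.

(** The exponents -a and a-1 add up to -1, which exactly cancels the Jacobian [d]. This scale
    invariance is why Abel integrals of complementary orders compose to plain integration. *)
Lemma beta_scale a d : 0 < a < 1 -> 0 < d ->
  (\int[mu]_u (kern (1 - a) (d - u) * kern a u)%:E = (betaI a)%:E)%E.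
Proof.
move=> a01 d0; rewrite (ge0_integral_scale_translate 0 d0); last 2 first.
  - by apply/measurable_EFinP; exact: measurable_beta_integrand.
  - by move=> u; rewrite lee_fin mulr_ge0// kern_ge0.
have E u : (kern (1 - a) (d - (0 + d * u)) * kern a (0 + d * u))%:E =
    (d^-1%:E * (kern (1 - a) (1 - u) * kern a u)%:E)%E.
  have -> : d - (0 + d * u) = d * (1 - u) by ring.
  rewrite add0r !kern_scale// -EFinM; congr EFin.
  rewrite mulrACA -powRD; last by apply/implyP => _; rewrite gt_eqF.
  have -> : 1 - a - 1 + (a - 1) = -1 by ring.
  by rewrite powR_inv1// ltW.
under eq_integral do rewrite E.
rewrite ge0_integralZl//; last 3 first.
- by apply/measurable_EFinP; exact: measurable_beta_integrand.
- by move=> u _; rewrite lee_fin mulr_ge0// kern_ge0.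
- by rewrite lee_fin invr_ge0 ltW.
by rewrite -EFin_betaI// -!EFinM mulrA divff ?gt_eqF// mul1r.
Qed.

Lemma beta_conv a t s : 0 < a < 1 ->
  (\int[mu]_v (kern (1 - a) (t - v) * kern a (v - s))%:E =
   (if s < t then betaI a else 0)%:E)%E.
Proof.
move=> a01; rewrite (ge0_integral_scale_translate s ltr01); last 2 first.
  - apply/measurable_EFinP/measurable_funM; first exact: measurable_kern_refl.
    by apply: (measurableT_comp (measurable_kern a)); exact: measurable_funB.
  - by move=> u; rewrite lee_fin mulr_ge0// kern_ge0.
rewrite mul1e; under eq_integral => u _ do
  rewrite mul1r (addrC s) addrK opprD addrCA addrC.
case: ifPn => [st|]; first by rewrite beta_scale// subr_gt0.
rewrite -leNgt => ts; rewrite integral0_eq// => u _.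
have [u0|u0] := leP u 0; first by rewrite (kern_npos a u0) mulr0.
by rewrite kern_npos ?mul0r//; lra.
Qed.

End ChangeOfVariables.

(** * Composition of Abel integrals *)

Section Abel.
Context {R : realType}.
Local Notation mu := (@lebesgue_measure R).
Implicit Types (a b s t u T : R) (g h : R -> R).

Definition abel a h t : R := \int[mu]_s (kern a (t - s) * h s).

Lemma EFin_abel a h t :
  mu.-integrable [set: R] (fun s => (kern a (t - s) * h s)%:E) ->
  ((abel a h t)%:E = \int[mu]_s (kern a (t - s) * h s)%:E)%E.
Proof. by move=> ih; rewrite /abel /Rintegral fineK// (integrable_fin_num _ ih). Qed.

(** After Fubini the inner integral is [beta_conv]: the composed kernel is [betaI a] times the
    indicator of s < t. *)
Lemma abel_comp a h t : 0 < a < 1 -> measurable_fun [set: R] h ->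
  (forall s, s <= 0 -> h s = 0) ->
  mu.-integrable `[0, t] (EFin \o h) ->
  (forall v, mu.-integrable [set: R] (fun s => (kern a (v - s) * h s)%:E)) ->
  abel (1 - a) (abel a h) t = betaI a * \int[mu]_(s in `[0, t]) h s.
Proof.
move=> a01 mh h0 ih ikh.
have B0 : 0 <= betaI a by rewrite (le_trans ler01)// betaI_ge1.
pose H (x : measurableTypeR R * measurableTypeR R) : \bar R :=
  (kern (1 - a) (t - x.1) * (kern a (x.1 - x.2) * h x.2))%:E.
have mH : measurable_fun [set: measurableTypeR R * measurableTypeR R] H.
  apply/measurable_EFinP; apply: measurable_funM.
    apply: (measurableT_comp (measurable_kern (1 - a))).
    by apply: measurable_funB => //; exact: measurable_fst.
  apply: measurable_funM; last by apply: (measurableT_comp mh); exact: measurable_snd.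
  apply: (measurableT_comp (measurable_kern a)).
  by apply: measurable_funB; [exact: measurable_fst|exact: measurable_snd].
have ib s : mu.-integrable [set: R]
    (fun v => (kern (1 - a) (t - v) * kern a (v - s))%:E).
  apply/integrableP; split.
    apply/measurable_EFinP; apply: measurable_funM; first exact: measurable_kern_refl.
    by apply: (measurableT_comp (measurable_kern a)); exact: measurable_funB.
  under eq_integral => u _ do rewrite /= ger0_norm ?mulr_ge0 ?kern_ge0//.
  by rewrite beta_conv// ltry.
have ih' : mu.-integrable `[0, t[ (EFin \o h).
  apply: integrableS ih => //.
  by move=> x /=; rewrite !in_itv/= => /andP[-> /ltW].
(* The indicator of s < t and the vanishing of [h] on the nonpositive axis together restrict to [[0,
   t[]; the endpoint [t] is restored at the end as a null point. *)
have hE s : (if s < t then betaI a else 0) * h s = betaI a * (h \_ `[0, t[) s.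
  rewrite patchE mem_setE in_itv/=; case: ifPn => st; last by rewrite mul0r andbF mulr0.
  by rewrite andbT; case: leP => // s0; rewrite h0 ?ltW.
(* Tonelli with [v] integrated first: the inner integral is again a Beta integral and leaves a
   multiple of |h| on [[0, t[]. *)
have iH : (mu \x mu)%E.-integrable setT H.
  apply/integrable21ltyP => //.
  have E s : (\int[mu]_v `|H (v, s)| = (betaI a * `|(h \_ `[0, t[) s|)%:E)%E.
    under eq_integral => v _.
      rewrite /H /= normrM (ger0_norm (kern_ge0 _ _)) normrM (ger0_norm (kern_ge0 _ _)).
      rewrite mulrA EFinM muleC; over.
    rewrite ge0_integralZl//; last 2 first.
      - exact: (measurable_int _ (ib s)).
      - by move=> v _; rewrite lee_fin mulr_ge0// kern_ge0.
    rewrite beta_conv// -EFinM mulrC -[X in X * _]ger0_norm; last by case: ifP.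
    by rewrite -normrM hE normrM (ger0_norm B0).
  under eq_integral do rewrite E.
  under eq_integral do rewrite EFinM.
  have : mu.-integrable [set: R] (EFin \o (h \_ `[0, t[)).
    by rewrite -restrict_EFin -integrable_mkcond.
  move/(integrableZl measurableT (betaI a))/integrableP => [_].
  by under eq_integral => s _ do rewrite /= normrM (ger0_norm B0) EFinM.
have := Fubini iH.
have -> : (\int[mu]_v \int[mu]_s H (v, s) =
           \int[mu]_v (kern (1 - a) (t - v) * abel a h v)%:E)%E.
  apply: eq_integral => v _; rewrite EFinM EFin_abel//.
  by rewrite -integralZl.
have -> : (\int[mu]_s \int[mu]_v H (v, s) =
           \int[mu]_s (betaI a * (h \_ `[0%R, t[) s)%:E)%E.
  apply: eq_integral => s _; rewrite -hE EFinM -beta_conv// -integralZr//.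
  by apply: eq_integral => v _; rewrite /H /= -EFinM mulrA.
move=> E; rewrite /abel /Rintegral E -/(Rintegral _ _ _) -Rintegral_itv_bndo_bndc//.
rewrite [X in _ = _ * X]Rintegral_mkcond -RintegralZl//.
by rewrite -restrict_EFin -integrable_mkcond.
Qed.

End Abel.

(** * Estimates for weights in L^p *)

Section Bounds.
Context {R : realType}.
Local Notation mu := (@lebesgue_measure R).
Implicit Types (a b s t u T : R) (g h : R -> R).

(** Young's inequality with exponents [p] and q = p/(p-1), whose factors 1/p and 1/q are at most 1
    and are dropped. The q-th power of [kern a] is again a kernel, with a'-1 = (a-1)q. *)
Lemma kern_young (p a u x : R) : 1 < p -> 0 <= x ->
  kern a u * x <= x `^ p + kern (1 - (1 - a) * (p / (p - 1))) u.
Proof.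
move=> p1 x0; have [u0|u0] := leP u 0.
  by rewrite !(kern_npos _ u0) mul0r addr0 powR_ge0.
have p0 : 0 < p by exact: lt_trans p1.
have pm : 0 < p - 1 by rewrite subr_gt0.
set q := p / (p - 1).
have q0 : 0 < q by rewrite divr_gt0.
have pq : q^-1 + p^-1 = 1 by rewrite /q; field; rewrite !gt_eqF.
have := conjugate_powR (kern_ge0 a u) x0 q0 p0 pq; move/le_trans; apply.
rewrite addrC; apply: lerD.
  by rewrite ler_pdivrMr// ler_peMr ?powR_ge0// ltW.
rewrite ler_pdivrMr// !kern_pos// -powRrM.
rewrite [X in _ <= u `^ X * _](_ : _ = (a - 1) * q); last by ring.
rewrite ler_peMr ?powR_ge0// /q ler_pdivlMr// mul1r; lra.
Qed.

(** The claim (1-a)p < p-1 is 1 < a p. Thus [a^-1 < p] is exactly what keeps the kernel produced by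
    [kern_young] integrable at 0. *)
Lemma kern_young_exponent (p a : R) : 0 < a < 1 -> a^-1 < p ->
  0 < 1 - (1 - a) * (p / (p - 1)).
Proof.
move=> /andP[a0 a1] ap.
have p1 : 1 < p by apply: lt_trans ap; rewrite invf_gt1.
have pm : 0 < p - 1 by rewrite subr_gt0.
rewrite subr_gt0 mulrA ltr_pdivrMr// mul1r.
have : 1 < a * p by rewrite -(mulfV (lt0r_neq0 a0)) ltr_pM2l.
lra.
Qed.

Section HolderBound.
Variables (p T : R) (g : R -> R).
Hypotheses (p1 : 1 < p) (T0 : 0 < T) (mg : measurable_fun [set: R] g).
Hypothesis g0 : forall s, ~~ (0 <= s <= T) -> g s = 0.
Hypothesis gp : (\int[mu]_s (`|g s| `^ p)%:E < +oo)%E.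

(** Young's inequality separates [g] from the kernel additively, so the bound is the integral of
    |g|^p plus that of a truncated kernel, and neither depends on [t]. Truncation at [T] is
    harmless: where [g] is nonzero, both s and t-s are at most [T]. *)
Lemma holder_bound a : 0 < a < 1 -> a^-1 < p -> exists2 C : R, 0 <= C &
  (\int[mu]_s (kern a s * `|g s|)%:E <= C%:E)%E /\
  forall t, t <= T -> (\int[mu]_s (kern a (t - s) * `|g s|)%:E <= C%:E)%E.
Proof.
move=> a01 ap; have := kern_young_exponent a01 ap.
set a' := 1 - _ => a'0.
have p0 : 0 < p by exact: lt_trans p1.
set G := (\int[mu]_s (`|g s| `^ p)%:E)%E.
have G0 : (0 <= G)%E by apply: integral_ge0 => s _; rewrite lee_fin powR_ge0.
have GE : G = (fine G)%:E by rewrite fineK// ge0_fin_numE.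
have mng : measurable_fun [set: R] (fun s => `|g s|) by exact: measurableT_comp.
have mgp : measurable_fun [set: R] (fun s => `|g s| `^ p).
  by apply: (measurableT_comp (measurable_powR p)).
exists (1 * (fine G + T `^ a' / a')).
  by rewrite mul1r addr_ge0// ?fine_ge0// divr_ge0 ?powR_ge0// ltW.
split=> [|t tT].
- apply: (integral_le_combination _ mgp (measurable_kcut a' T)) => //.
  + by apply: measurable_funM => //; exact: measurable_kern.
  + by move=> s; rewrite mulr_ge0 ?kern_ge0.
  + by move=> s; rewrite kcut_ge0.
  + move=> s; rewrite mul1r; have [sT|sT] := leP s T.
      by rewrite kcutE//; exact: kern_young.
    rewrite (@g0 s) ?normr0 ?mulr0; last by rewrite [s <= T]leNgt sT andbF.
    by rewrite addr_ge0 ?powR_ge0 ?kcut_ge0.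
  + by rewrite -GE.
  + exact: integral_kcut_le.
- have mk : measurable_fun [set: R] (fun s => kcut a' T (t - s)).
    by apply: (measurableT_comp (measurable_kcut _ _)); exact: measurable_funB.
  apply: (integral_le_combination _ mgp mk) => //.
  + by apply: measurable_funM => //; exact: measurable_kern_refl.
  + by move=> s; rewrite mulr_ge0 ?kern_ge0.
  + by move=> s; rewrite kcut_ge0.
  + move=> s; rewrite mul1r; have [s0|s0] := leP 0 s.
      by rewrite kcutE; [exact: kern_young|lra].
    rewrite (@g0 s) ?normr0 ?mulr0; last by rewrite leNgt s0.
    by rewrite addr_ge0 ?powR_ge0 ?kcut_ge0.
  + by rewrite -GE.
  + exact: integral_kcut_reflect_le.
Qed.

End HolderBound.

(** * Convolution estimate with singularities at both endpoints *)

Section ConvBound.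
Variables (a b T C : R) (g : R -> R).
Hypotheses (b01 : 0 < b < 1) (mg : measurable_fun [set: R] g).
Hypothesis gC : (\int[mu]_s (kern a s * `|g s|)%:E <= C%:E)%E.
Hypothesis gCr : forall t, t <= T ->
  (\int[mu]_s (kern a (t - s) * `|g s|)%:E <= C%:E)%E.

(* Used with lam = 0, m = t^(b-a), and with lam > 0, m = lam^(a-b). *)
Lemma kern_split lam m t s : 0 < t -> 0 <= lam -> 0 <= m ->
  (forall u, 0 < u < t -> u `^ (b - a) * expR (- (lam * u)) <= m) ->
  kern b (t - s) * kern b s * expR (- (lam * (t - s))) <=
  2 * t `^ (b - 1) * m * (kern a s + kern a (t - s)).
Proof.
move=> t0 lam0 m0 hm.
have rhs0 : 0 <= 2 * t `^ (b - 1) * m * (kern a s + kern a (t - s)).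
  by rewrite !mulr_ge0 ?powR_ge0 ?addr_ge0 ?kern_ge0.
have [s0|s0] := leP s 0; first by rewrite (kern_npos _ s0) mulr0 mul0r.
have [ts|st] := leP t s; first by rewrite (@kern_npos _ _ (t - s)) ?mul0r// subr_le0.
(* Of the two arguments, the larger [v] is at least t/2, so its kernel is at most 2 t^(b-1). The
   smaller one is written u^(b-1) = u^(b-a) u^(a-1), and u^(b-a) with the exponential is absorbed by
   [m]. *)
have key u v : 0 < u -> u <= v -> u + v = t ->
    kern b v * kern b u * expR (- (lam * u)) <= 2 * t `^ (b - 1) * m * kern a u.
  move=> u0 uv uvt; have v0 := lt_le_trans u0 uv.
  rewrite -mulrA -[leRHS]mulrA; apply: ler_pM.
  - exact: kern_ge0.
  - by rewrite mulr_ge0 ?kern_ge0 ?expR_ge0.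
  - by rewrite kern_pos//; apply: powR_half_le => //; lra.
  - rewrite !kern_pos// (_ : b - 1 = (b - a) + (a - 1)); last by ring.
    rewrite powRD; last by apply/implyP => _; rewrite gt_eqF.
    rewrite mulrAC ler_wpM2r ?powR_ge0//; apply: hm; lra.
have ts0 : 0 < t - s by rewrite subr_gt0.
have c0 : 0 <= 2 * t `^ (b - 1) * m by rewrite !mulr_ge0 ?powR_ge0.
rewrite [leRHS]mulrDr; have [s2|s2] := leP s (t - s).
  apply: ler_wpDr; first by rewrite mulr_ge0 ?kern_ge0.
  have sE : s + (t - s) = t by ring.
  (* Here the exponential sits on the larger argument; passing to the smaller one only weakens the
     decay. *)
  apply: le_trans (key s (t - s) s0 s2 sE).
  rewrite ler_wpM2l ?mulr_ge0 ?kern_ge0// ler_expR lerN2.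
  by rewrite ler_wpM2l.
apply: ler_wpDl; first by rewrite mulr_ge0 ?kern_ge0.
by rewrite [kern b (t - s) * _]mulrC; apply: key => //; [exact: ltW|ring].
Qed.

Lemma measurable_conv_weight lam t : measurable_fun [set: R]
  (fun s => kern b (t - s) * kern b s * expR (- (lam * (t - s))) * `|g s|).
Proof.
apply: measurable_funM; last exact: measurableT_comp.
apply: measurable_funM.
  by apply: measurable_funM; [exact: measurable_kern_refl|exact: measurable_kern].
apply: measurableT_comp => //; apply: measurableT_comp => //.
by apply: measurable_funM => //; exact: measurable_funB.
Qed.

Lemma conv_bound lam m t : 0 < t -> t <= T -> 0 <= lam -> 0 <= m ->
  (forall u, 0 < u < t -> u `^ (b - a) * expR (- (lam * u)) <= m) ->
  (\int[mu]_s (kern b (t - s) * kern b s * expR (- (lam * (t - s))) * `|g s|)%:E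
    <= (2 * t `^ (b - 1) * m * (C + C))%:E)%E.
Proof.
move=> t0 tT lam0 m0 hm.
apply: (integral_le_combination (G := fun s => kern a s * `|g s|)
  (H := fun s => kern a (t - s) * `|g s|) _ _ _ _ _ _ _ _ gC (gCr tT)).
- exact: measurable_conv_weight.
- by apply: measurable_funM; [exact: measurable_kern|exact: measurableT_comp].
- by apply: measurable_funM; [exact: measurable_kern_refl|exact: measurableT_comp].
- by rewrite !mulr_ge0 ?powR_ge0.
- by move=> u; rewrite !mulr_ge0 ?kern_ge0 ?expR_ge0.
- by move=> u; rewrite !mulr_ge0 ?kern_ge0.
- by move=> u; rewrite !mulr_ge0 ?kern_ge0.
- move=> s; rewrite -mulrDl mulrA ler_wpM2r//; exact: kern_split.
Qed.

End ConvBound.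

(** With w = lam u the claim is w^d <= e^w, that is d ln w <= w, which follows from d <= 1 and ln w
    <= w - 1 when ln w is positive. The right side tends to 0 as [lam] grows, for d > 0: this is the
    source of the contraction. *)
Lemma powR_expRN_le (d lam u : R) : 0 <= d <= 1 -> 0 < lam -> 0 < u ->
  u `^ d * expR (- (lam * u)) <= lam `^ (- d).
Proof.
move=> /andP[d0 d1] lam0 u0.
have lu0 : 0 < lam * u by rewrite mulr_gt0.
rewrite expRN ler_pdivrMr ?expR_gt0// powRN mulrC ler_pdivlMr ?powR_gt0//.
rewrite mulrC -(powRM _ (ltW lam0) (ltW u0)) /powR gt_eqF//= ler_expR.
have [l1|l1] := leP (ln (lam * u)) 0.
  by apply: (@le_trans _ _ 0); [rewrite mulr_ge0_le0|exact: ltW].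
apply: (@le_trans _ _ (ln (lam * u))); first by rewrite ger_pMl.
have := @le_ln1Dx _ (lam * u - 1); rewrite addrCA subrr addr0 => /(_ _); lra.
Qed.

End Bounds.

(** * Absolutely continuous functions with zero derivative *)

Section AbsolutelyContinuous.
Context {R : realType}.
Local Notation mu := (@lebesgue_measure R).

Lemma is_derive0_near (D : R -> R) (c e : R) : 0 < e -> is_derive c 1 D 0 ->
  exists2 r : R, 0 < r & forall y, `|y - c| < r -> `|D y - D c| <= e * `|y - c|.
Proof.
move=> e0 [dD D0].
have : h^-1 *: ((D \o shift c) (h *: 1) - D c) @[h --> 0^'] --> 'D_1 D c.
  exact: dD.
rewrite D0 => /cvgrPdist_le => /(_ e e0); rewrite near_withinE => -[r /= r0 hr].
exists r => // y yc; have [->|ync] := eqVneq y c; first by rewrite !subrr normr0 mulr0.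
have yc0 : y - c != 0 by rewrite subr_eq0.
have := hr (y - c); rewrite /ball_ /= sub0r normrN => /(_ yc yc0).
rewrite sub0r normrN scaler1 subrK normrM normfV mulrC.
by rewrite ler_pdivrMr// normr_gt0.
Qed.

(** * Covering an interval by small-slope steps and intervals of an open set *)

Section Cousin.
Variables (a b e : R) (D : R -> R) (U : set R).
Hypotheses (ab : a < b) (e0 : 0 < e) (oU : open U).
Hypothesis derD : forall t, a <= t <= b -> ~ U t -> is_derive t 1 D 0.

(** There are two ways to advance. Where the derivative vanishes, the increment is paid at slope
    [e]; inside [U] nothing is known about [D], so the interval is recorded, to be paid for later by
    absolute continuity. *)
Let reach t := exists n (u v : 'I_n -> R),
  [/\ forall i, [/\ a <= u i, u i < v i & v i <= t],
      trivIset setT (fun i => `]u i, v i[%classic),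
      forall i, `]u i, v i[%classic `<=` U &
      `|D t - D a| <= e * (t - a) + \sum_(i < n) `|D (v i) - D (u i)|].

Let reach_slope s t : s <= t -> reach s -> `|D t - D s| <= e * (t - s) -> reach t.
Proof.
move=> st [n [u [v [uv tr Uuv Ds]]]] Dst; exists n, u, v; split => //.
  by move=> i; have [? ? vs] := uv i; split => //; exact: le_trans st.
rewrite (_ : D t - D a = (D t - D s) + (D s - D a)); last by ring.
rewrite (le_trans (ler_normD _ _))//.
rewrite (_ : e * (t - a) = e * (t - s) + e * (s - a)); last by ring.
by rewrite -addrA lerD.
Qed.

Let reach_open s t : a <= s -> s < t -> reach s -> `]s, t[%classic `<=` U -> reach t.
Proof.
move=> as_ st [n [u [v [uv tr Uuv Ds]]]] Ust.
pose u' (i : 'I_n.+1) := oapp u s (unlift ord0 i).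
pose v' (i : 'I_n.+1) := oapp v t (unlift ord0 i).
exists n.+1, u', v'; split.
- move=> i; rewrite /u' /v'; case: unliftP => [j _|_] /=; last by split.
  by have [? ? vs] := uv j; split => //; rewrite (le_trans vs)// ltW.
- apply/trivIsetP => i j _ _; apply: contra_neqP => /eqP/set0P[x []].
  rewrite /u' /v'; case: unliftP => [i' ->|->] /=; case: unliftP => [j' ->|->] //=.
  + move=> xi xj; congr lift; move/trivIsetP : tr => tr.
    apply: contrapT => /eqP ij; have := tr _ _ I I ij.
    by move/seteqP => [/(_ x) + _]; apply.
  + rewrite !in_itv/= => /andP[_ xv] /andP[sx _]; have [_ _ vs] := uv i'.
    by have := lt_trans sx (lt_le_trans xv vs); rewrite ltxx.
  + rewrite !in_itv/= => /andP[sx _] /andP[_ xv]; have [_ _ vs] := uv j'.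
    by have := lt_trans sx (lt_le_trans xv vs); rewrite ltxx.
- by move=> i; rewrite /u' /v'; case: unliftP => [j _|_] //=.
- rewrite big_ord_recl {1 2}/u' {1 2}/v' unlift_none /=.
  under eq_bigr => i _ do rewrite /u' /v' liftK /=.
  rewrite (_ : D t - D a = (D t - D s) + (D s - D a)); last by ring.
  rewrite (le_trans (ler_normD _ _))// addrCA lerD2l.
  by apply: (le_trans Ds); rewrite lerD2r ler_pM2l// lerD2r ltW.
Qed.

(** The radius [r] is the gauge at [c]: a ball inside [U] if [c] lies in [U], otherwise the range
    where the zero derivative forces slope at most [e]. *)
Let reach_near c : a <= c <= b -> exists2 r : R, 0 < r &
  (forall s, a <= s -> c - r < s -> s < c -> reach s -> reach c) /\
  (forall t, c < t -> t < c + r -> reach c -> reach t).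
Proof.
move=> /[dup] acb /andP[ac cb].
have [Uc|nUc] := pselect (U c).
  have /nbhs_ballP[r /= r0 crU] : nbhs c U by exact: open_nbhs_nbhs.
  exists r => //; split=> [s as_ crs sc rs|t ct tcr rc].
    apply: (reach_open as_ sc rs) => x /=; rewrite in_itv/= => /andP[sx xc].
    by apply: crU; rewrite /ball/= ltr_distlC; apply/andP; split; lra.
  apply: (reach_open ac ct rc) => x /=; rewrite in_itv/= => /andP[cx xt].
  by apply: crU; rewrite /ball/= ltr_distlC; apply/andP; split; lra.
have [r r0 hr] := is_derive0_near e0 (derD acb nUc).
exists r => //; split=> [s as_ crs sc rs|t ct tcr rc].
  apply: (reach_slope (ltW sc) rs).
  rewrite distrC (le_trans (hr s _))// ltr0_norm ?subr_lt0 ?opprB//; lra.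
apply: (reach_slope (ltW ct) rc).
by rewrite (le_trans (hr t _))// gtr0_norm ?subr_gt0//; lra.
Qed.

(* Cousin's covering argument, run as a supremum argument. *)
Lemma gauge_partition : reach b.
Proof.
have ra : reach a.
  exists 0%N, (fun=> 0), (fun=> 0); split; [by case|by apply/trivIsetP; case|by case|].
  by rewrite big_ord0 !subrr normr0 mulr0 addr0.
pose S := [set t | a <= t <= b /\ reach t].
have Sa : S a by split; rewrite // lexx ltW.
have ubS : ubound S b by move=> t [/andP[_]].
have supS : has_sup S by split; [exists a|exists b].
pose c := sup S.
have ac : a <= c by apply: sup_upper_bound.
have cb : c <= b by apply: ge_sup => //; exists a.
have [|r r0 [rl rr]] := reach_near (c := c); first by rewrite ac cb.
have rc : reach c.
  have [s [/andP[as_ sb] rs] crs] := sup_adherent r0 supS.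
  have : s <= c by apply: sup_upper_bound => //; split; rewrite // as_ sb.
  by rewrite le_eqVlt => /predU1P[<-//|sc]; exact: (rl s).
move: (cb); rewrite le_eqVlt => /predU1P[<-//|cltb].
pose t := Num.min b (c + r / 2).
have ct : c < t by rewrite lt_min cltb/= ltrDl divr_gt0.
have tcr : t < c + r by rewrite gt_min; apply/orP; right; lra.
have : t <= c.
  apply: sup_upper_bound => //; split; last exact: rr rc.
  by rewrite (le_trans ac (ltW ct))/= ge_min lexx.
by rewrite leNgt ct.
Qed.

End Cousin.

(** By outer regularity the exceptional null set lies in an open [U] of measure below the [d] that
    absolute continuity assigns to [e]. The recorded disjoint intervals lie in [U], so together they
    cost less than [e]; all other steps cost at most e(b-a). *)
Lemma absolutely_continuous_derive0 (a b : R) (D : R -> R) : a < b ->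
  absolutely_continuous a b D ->
  {ae mu, forall t, a <= t <= b -> is_derive t 1 D 0} -> D b = D a.
Proof.
move=> ab acD [N [mN N0 NsubP]].
suff h e : 0 < e -> `|D b - D a| <= e * (b - a + 1).
  apply/eqP; rewrite -subr_eq0 -normr_le0; apply/ler_addgt0Pr => e e0.
  rewrite add0r (le_trans (h (e / (b - a + 1)) _))//.
    by rewrite divr_gt0//; lra.
  by rewrite divfK// gt_eqF//; lra.
move=> e0; have [d d0 acd] := acD e e0.
have [|U [oU NU Ud]] := lebesgue_regularity_outer mN _ d0.
  by apply: le_lt_trans (ltry (0 : R)); rewrite le_eqVlt; apply/orP; left; apply/eqP.
have mU : measurable U by exact: open_measurable.
have Ultd : (mu U < d%:E)%E.
  apply: le_lt_trans Ud; rewrite -[leRHS]adde0 -N0 -measureU//.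
  - by rewrite setUC setDUK.
  - exact: measurableD.
  - by apply/seteqP; split => // x [[]].
have derD t : a <= t <= b -> ~ U t -> is_derive t 1 D 0.
  move=> tab nUt; apply: contrapT => nd; apply: nUt; apply: NU; apply: NsubP => /=.
  by move=> /(_ tab).
have [n [u [v [uv tr Uuv Db]]]] := gauge_partition ab e0 oU derD.
rewrite mulrDr mulr1 (le_trans Db)// lerD2l ltW//.
apply: (acd _ u v) => //.
rewrite -lte_fin -sumEFin; apply: le_lt_trans Ultd.
rewrite (eq_bigr (fun i => mu `]u i, v i[%classic)); last first.
  by move=> i _; rewrite lebesgue_measure_itv/= lte_fin; have [_ -> _] := uv i.
have mUuv : measurable (\big[setU/set0]_(i < n) `]u i, v i[%classic).
  exact: bigsetU_measurable.
rewrite -measure_semi_additive_ord//; apply: le_measure; rewrite ?inE//.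
by elim/big_ind: _ => [//|A B AU BU|i _]; [rewrite subUset|exact: Uuv].
Qed.

End AbsolutelyContinuous.

(** * Continuity of Abel integrals *)

Section AbelContinuity.
Context {R : realType}.
Local Notation mu := (@lebesgue_measure R).

Lemma integral_reflect (t : R) (f : R -> \bar R) : measurable_fun [set: R] f ->
  (\int[mu]_u f u = \int[mu]_u f (t - u)%R)%E.
Proof.
move=> mf; rewrite [in LHS]integralE [in RHS]integralE.
rewrite (funepos_comp f (fun u => t - u)) (funeneg_comp f (fun u => t - u)).
congr (_ - _)%E; rewrite -ge0_integral_reflect//.
- exact: measurable_funepos.
- exact: measurable_funeneg.
Qed.

Lemma Rintegral_reflect (t : R) (f : R -> R) : measurable_fun [set: R] f ->
  \int[mu]_u f u = \int[mu]_u f (t - u).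
Proof.
by move=> mf; congr fine; rewrite (integral_reflect t)//; exact/measurable_EFinP.
Qed.

Lemma integrable_reflect (t : R) (f : R -> R) :
  mu.-integrable [set: R] (fun s => (f s)%:E) ->
  mu.-integrable [set: R] (fun s => (f (t - s))%:E).
Proof.
move=> /integrableP[mf fi]; apply/integrableP; split.
  by apply: (measurableT_comp mf); exact: measurable_funB.
rewrite -(ge0_integral_reflect t (f := fun s => `|(f s)%:E|%E))//.
exact: measurableT_comp.
Qed.

Lemma integrable_scale (D : set (measurableTypeR R)) (k : R) (f : R -> R) : measurable D ->
  mu.-integrable D (EFin \o f) ->
  mu.-integrable D (EFin \o (fun s => k * f s)).
Proof. by move=> mD /(integrableZl mD k). Qed.

Lemma continuous_kern (a u : R) : 0 < u -> {for u, continuous (kern a)}.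
Proof.
move=> u0; have ck : {for u, continuous (fun v : R => v `^ (a - 1))}.
  apply: differentiable_continuous; apply/derivable1_diffP.
  by apply: derivable_powR; rewrite in_itv/= u0.
rewrite /prop_for /continuous_at kern_pos//; apply: cvg_trans ck; apply: near_eq_cvg.
by near=> v; rewrite kern_pos//; near: v; exact: lt_nbhsr.
Unshelve. all: by end_near. Qed.

Lemma within_itvoy_continuous (h : R -> R) :
  {within `]0, +oo[, continuous h} <-> forall s, 0 < s -> {for s, continuous h}.
Proof.
rewrite continuous_open_subspace//; split=> ch s.
  by move=> s0; apply: ch; rewrite inE/= in_itv/= s0.
by rewrite inE/= in_itv/= andbT; exact: ch.
Qed.

(** * Separating the singularity of the source at 0 from that of the kernel *)

Section Cutoff.
Variables (a c : R) (h : R -> R).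
Hypotheses (a01 : 0 < a < 1) (c0 : 0 < c) (mh : measurable_fun [set: R] h).
Hypothesis h0 : forall s, s <= 0 -> h s = 0.
Hypothesis ch : forall s, 0 < s -> {for s, continuous h}.
Hypothesis ih : forall T, mu.-integrable `[0, T] (fun s => (h s)%:E).
Hypothesis ikh : forall t,
  mu.-integrable [set: R] (fun s => (kern a (t - s) * h s)%:E).

(** A continuous ramp from 0 at [c] to 1 at 2c. The part [h1] keeps the singularity of [h] at 0 but
    lives on [[0, 2c]]; the part [h2] is continuous on the whole line. *)
Let chi (s : R) : R := Num.min 1 (Num.max 0 ((s - c) / c)).

Let chi_ge0 s : 0 <= chi s.
Proof. by rewrite le_min ler01 le_max lexx. Qed.

Let chi_le1 s : chi s <= 1.
Proof. by rewrite ge_min lexx. Qed.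

Let chi_eq0 s : s <= c -> chi s = 0.
Proof.
move=> sc; rewrite /chi max_l; first by rewrite min_r.
by rewrite pmulr_lle0 ?invr_gt0// subr_le0.
Qed.

Let chi_eq1 s : 2 * c <= s -> chi s = 1.
Proof.
move=> sc; rewrite /chi min_l// le_max; apply/orP; right.
by rewrite ler_pdivlMr//; lra.
Qed.

Let chi_continuous : continuous chi.
Proof.
move=> s; apply: (@continuous_min _ _ (cst 1) (fun s => Num.max 0 ((s - c) / c))).
  exact: cvg_cst.
apply: (@continuous_max _ _ (cst 0) (fun s => (s - c) / c)).
  exact: cvg_cst.
by apply: cvgM; [apply: cvgB; [exact: cvg_id|exact: cvg_cst]|exact: cvg_cst].
Qed.

Let mchi : measurable_fun [set: R] chi.
Proof. exact: continuous_measurable_fun. Qed.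

Let h1 s := (1 - chi s) * h s.
Let h2 s := chi s * h s.

Let mh1 : measurable_fun [set: R] h1.
Proof. by apply: measurable_funM => //; exact: measurable_funB. Qed.

Let mh2 : measurable_fun [set: R] h2.
Proof. exact: measurable_funM. Qed.

Let norm_h1 s : `|h1 s| <= `|h s|.
Proof.
by rewrite normrM ler_piMl// ger0_norm ?subr_ge0// lerBlDr lerDl.
Qed.

Let norm_h2 s : `|h2 s| <= `|h s|.
Proof. by rewrite normrM ler_piMl// ger0_norm. Qed.

Let integrable_kern_le (g : R -> R) t : measurable_fun [set: R] g ->
  (forall s, `|g s| <= `|h s|) ->
  mu.-integrable [set: R] (fun s => (kern a (t - s) * g s)%:E).
Proof.
move=> mg gh; apply: le_integrable (ikh t) => //.
  apply/measurable_EFinP; apply: measurable_funM => //; exact: measurable_kern_refl.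
by move=> s _; rewrite /= lee_fin !normrM ler_wpM2l.
Qed.

Let continuous_h2 : continuous h2.
Proof.
move=> s; have [s0|s0] := ltP 0 s.
  by apply: continuousM; [exact: chi_continuous|exact: ch].
have sc : s < c by exact: le_lt_trans c0.
have h2s u : u < c -> h2 u = 0 by move=> uc; rewrite /h2 chi_eq0 ?mul0r// ltW.
rewrite /continuous_at h2s//; apply: cvg_near_cst.
by near=> u; rewrite h2s//; near: u; exact: lt_nbhsl.
Unshelve. all: by end_near. Qed.

(** To the right of 3c the kernel stays at distance at least [c] from the support of [h1]. The bound
    8c only has to leave room for t = 4c, the point at which the section is used. *)
Let I : set R := `](3 * c), (8 * c)[.

Let continuous_abel_h1 : {in I, continuous (abel a h1)}.
Proof.
have /andP[a0 a1] := a01.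
have h1_0 s : ~~ (0 <= s <= 2 * c) -> h1 s = 0.
  rewrite negb_and -!ltNge => /orP[s0|sc]; first by rewrite /h1 h0 ?mulr0// ltW.
  by rewrite /h1 chi_eq1 ?subrr ?mul0r// ltW.
have ih1 : mu.-integrable [set: R] (fun s => (h1 s)%:E).
  have : mu.-integrable [set: R] (EFin \o (h \_ `[0, (2 * c)])).
    by rewrite -restrict_EFin -integrable_mkcond.
  apply: le_integrable => //; first exact/measurable_EFinP.
  move=> s _ /=; rewrite lee_fin patchE mem_setE in_itv/=.
  by case: ifPn => [_|/h1_0 ->]; [exact: norm_h1|rewrite normr0].
apply: (@continuity_under_integral _ _ _ mu (fun t s => kern a (t - s) * h1 s)
  setT measurableT (3 * c) (8 * c) _ _ (fun s => c `^ (a - 1) * `|h1 s|)).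
- by move=> t _; exact: integrable_kern_le.
- apply: aeW => s _ t; move: (s : R) => {}s; rewrite inE /= in_itv/= => /andP[ct _].
  have [s0|] := boolP (0 <= s <= 2 * c); last first.
    move=> /h1_0 ->; rewrite (_ : (fun _ => _) = cst 0); first exact: cvg_cst.
    by apply/funext => x; rewrite mulr0.
  apply: (@continuousM _ _ (fun x => kern a (x - s)) (cst (h1 s))); last exact: cvg_cst.
  apply: (@continuous_comp _ _ _ (fun x => x - s) (kern a)).
    by apply: cvgB; [exact: cvg_id|exact: cvg_cst].
  apply: continuous_kern; rewrite subr_gt0; move: s0 => /andP[_ sc].
  by apply: (le_lt_trans sc); apply: lt_trans ct; rewrite ltr_pM2r// ltr_nat.
- apply: (@integrable_scale setT (c `^ (a - 1)) (fun s => `|h1 s|)) => //.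
  by have /integrable_norm := ih1.
- move=> t; rewrite /= in_itv/= => /andP[ct _]; apply: aeW => s _.
  move: (s : R) => {}s; rewrite normrM (ger0_norm (kern_ge0 _ _)).
  have [s0|/h1_0 ->] := boolP (0 <= s <= 2 * c); last by rewrite normr0 !mulr0.
  move: s0 => /andP[_ sc]; have cts : c <= t - s by have := c0; lra.
  rewrite ler_wpM2r// kern_pos; last exact: lt_le_trans cts.
  by apply: powR_neg_le => //; lra.
Qed.

Let continuous_abel_h2 : {in I, continuous (abel a h2)}.
Proof.
have /andP[a0 a1] := a01.
(* As [h2] vanishes left of [c], a maximum over the compact [[c, 8c]] bounds it on all of s <=
   8c. *)
have [M M0 hM] : exists2 M, 0 <= M & forall s, s <= 8 * c -> `|h2 s| <= M.
  have [||x _ xM] := @EVT_max _ (fun s => `|h2 s|) c (8 * c).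
      by have := c0; lra.
    by apply: continuous_subspaceT => s; apply: cvg_norm; exact: continuous_h2.
  exists `|h2 x| => // s sc; have [cs|cs] := leP c s; first by apply: xM; rewrite in_itv/= cs.
  by rewrite {1}/h2 chi_eq0 ?mul0r ?normr0// ltW.
(* Reflection moves the parameter [t] from the singular kernel into the continuous factor [h2],
   after which dominated convergence applies. *)
have abelE t : abel a h2 t = \int[mu]_u (kern a u * h2 (t - u)).
  rewrite /abel (Rintegral_reflect t); last first.
    by apply: measurable_funM => //; exact: measurable_kern_refl.
  apply: eq_Rintegral => u _; congr (kern a _ * _); ring.
rewrite (_ : abel a h2 = fun t => \int[mu]_u (kern a u * h2 (t - u))); last exact/funext.
apply: (@continuity_under_integral _ _ _ mu (fun t u => kern a u * h2 (t - u))
  setT measurableT (3 * c) (8 * c) _ _ (fun u => M * kcut a (8 * c) u)).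
- move=> t _; have := integrable_reflect t (integrable_kern_le t mh2 norm_h2).
  by under eq_fun => s do rewrite subKr.
- apply: aeW => u _ t _.
  apply: (@continuousM _ _ (cst (kern a u)) (fun x => h2 (x - u))); first exact: cvg_cst.
  apply: (@continuous_comp _ _ _ (fun x => x - u) h2); last exact: continuous_h2.
  by apply: cvgB; [exact: cvg_id|exact: cvg_cst].
- apply: (@integrable_scale setT M (kcut a (8 * c))) => //.
  apply/integrableP; split; first by apply/measurable_EFinP; exact: measurable_kcut.
  under eq_integral => u _ do rewrite /= ger0_norm ?kcut_ge0//.
  by apply: (le_lt_trans (integral_kcut_le a0 _)); rewrite ?ltry// mulr_gt0.
- move=> t; rewrite /= in_itv/= => /andP[ct tc]; apply: aeW => u _.
  move: (u : R) => {}u; rewrite normrM (ger0_norm (kern_ge0 _ _)) mulrC.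
  have [u0|u0] := leP u 0; first by rewrite (kern_npos _ u0) mulr0 mulr_ge0 ?kcut_ge0.
  have [tu|tu] := leP (t - u) c.
    by rewrite {1}/h2 chi_eq0// mul0r normr0 mul0r mulr_ge0 ?kcut_ge0.
  by rewrite kcutE; [rewrite ler_wpM2r ?kern_ge0// hM//; lra|lra].
Qed.

Lemma continuous_abel_itv t : 3 * c < t < 8 * c -> {for t, continuous (abel a h)}.
Proof.
move=> tc; have It : t \in I by apply/mem_set; rewrite /I/= in_itv.
rewrite (_ : abel a h = fun t => abel a h1 t + abel a h2 t).
  by apply: continuousD; [exact: continuous_abel_h1|exact: continuous_abel_h2].
apply/funext => u; rewrite /abel -RintegralD//.
- by apply: eq_Rintegral => s _; rewrite /h1 /h2; ring.
- exact: integrable_kern_le.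
- exact: integrable_kern_le.
Qed.

End Cutoff.

Lemma continuous_abel (a : R) (h : R -> R) : 0 < a < 1 ->
  measurable_fun [set: R] h -> (forall s, s <= 0 -> h s = 0) ->
  (forall s, 0 < s -> {for s, continuous h}) ->
  (forall T, mu.-integrable `[0, T] (fun s => (h s)%:E)) ->
  (forall t, mu.-integrable [set: R] (fun s => (kern a (t - s) * h s)%:E)) ->
  forall t, 0 < t -> {for t, continuous (abel a h)}.
Proof.
move=> a01 mh h0 ch ih ikh t t0.
by apply: (@continuous_abel_itv a (t / 4)) => //; [lra|apply/andP; split; lra].
Qed.

End AbelContinuity.

(** * Riemann-Liouville integrals as Abel integrals *)

Section PositivePart.
Context {R : realType}.
Local Notation mu := (@lebesgue_measure R).

(** Values at s <= 0 carry no meaning in the problem, yet [abel] integrates over the whole line, so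
    they are set to 0. *)
Definition pospart (h : R -> R) : R -> R := h \_ `]0, +oo[.

Lemma pospart_gt0 (h : R -> R) s : 0 < s -> pospart h s = h s.
Proof. by move=> s0; rewrite /pospart patchE mem_setE in_itv/= s0. Qed.

Lemma pospart_le0 (h : R -> R) s : s <= 0 -> pospart h s = 0.
Proof. by move=> s0; rewrite /pospart patchE mem_setE in_itv/= ltNge s0. Qed.

Lemma measurable_pospart (h : R -> R) : (forall s, 0 < s -> {for s, continuous h}) ->
  measurable_fun [set: R] (pospart h).
Proof.
move=> ch; apply/(measurable_restrictT h (measurable_itv `]0, +oo[)).
apply: open_continuous_measurable_fun => // s; rewrite inE/= in_itv/= andbT.
exact: ch.
Qed.

Lemma near_eq_continuous (g h : R -> R) (t : R) : (\forall s \near t, g s = h s) ->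
  {for t, continuous h} -> {for t, continuous g}.
Proof.
move=> gh ch; have gt : g t = h t by exact: nbhs_singleton gh.
rewrite /prop_for /continuous_at gt; apply: cvg_trans ch; apply: near_eq_cvg.
by near=> s; apply/esym; near: s.
Unshelve. all: by end_near. Qed.

Lemma near_pospart (h : R -> R) (t : R) : 0 < t -> \forall s \near t, pospart h s = h s.
Proof.
by move=> t0; near=> s; rewrite pospart_gt0//; near: s; exact: lt_nbhsr.
Unshelve. all: by end_near. Qed.

Lemma continuous_pospart (h : R -> R) (t : R) : 0 < t ->
  {for t, continuous h} -> {for t, continuous (pospart h)}.
Proof. by move=> t0; apply: near_eq_continuous; exact: near_pospart. Qed.

Lemma abel_npos (a : R) (h : R -> R) t : (forall s, s <= 0 -> h s = 0) ->
  t <= 0 -> abel a h t = 0.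
Proof.
move=> h0 t0; rewrite /abel (_ : (fun s => _) = cst 0); first by rewrite Rintegral_cst// mul0r.
apply/funext => s; have [s0|s0] := leP s 0; first by rewrite h0// mulr0.
by rewrite kern_npos ?mul0r// subr_le0 (le_trans t0)// ltW.
Qed.

(** The integrands agree on []0, t]]; at s = t both are 0, on the left because the inverse of 0 is
    0. The point s = 0, where [h] is arbitrary, is discarded as null. *)
Lemma RL_integral_abel (a : R) (h : R -> R) t : 0 < a < 1 ->
  (forall s, 0 < s -> {for s, continuous h}) ->
  RL_integral a h t = (Gamma a)^-1 * abel a (pospart h) t.
Proof.
move=> /andP[a0 a1] ch; congr (_ * _).
have E s : 0 < s <= t -> h s / (t - s) `^ (1 - a) = kern a (t - s) * pospart h s.
  move=> /andP[s0 st]; rewrite pospart_gt0// mulrC; congr (_ * _).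
  have [ts|ts] := ltP s t; last first.
    have -> : s = t by apply/eqP; rewrite eq_le st ts.
    rewrite subrr powR0 ?invr0 ?kern_npos// subr_eq0; apply/eqP; lra.
  by rewrite kern_pos ?subr_gt0// -powRN opprB.
have mk : measurable_fun [set: R] (fun s => kern a (t - s) * pospart h s).
  by apply: measurable_funM; [exact: measurable_kern_refl|exact: measurable_pospart].
rewrite /Rintegral -integral_itv_obnd_cbnd; last first.
  apply: (eq_measurable_fun (EFin \o (fun s => kern a (t - s) * pospart h s))).
    by move=> s; rewrite inE/= in_itv/= => st; rewrite E.
  by apply/measurable_EFinP; exact: measurable_funTS.
rewrite integral_mkcond /abel /Rintegral; congr fine; apply: eq_integral => s _.
rewrite patchE; case: ifPn => [|]; rewrite mem_setE in_itv/= => st; first by rewrite E.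
move: st; rewrite negb_and -leNgt -ltNge => /orP[s0|ts].
  by rewrite pospart_le0// mulr0.
by rewrite kern_npos ?mul0r// subr_le0 ltW.
Qed.

Lemma integral_expRN_lty : (\int[mu]_(t in `[0%R, +oo[) (expR (- t))%:E < +oo)%E.
Proof.
rewrite (@ge0_continuous_FTC2y R (fun t => expR (- t)) (fun t => - expR (- t)) 0 0).
- by rewrite ltry.
- by move=> x _; rewrite expR_ge0.
- apply: continuous_subspaceT => x; apply: continuous_comp; last exact: continuous_expR.
  exact: opp_continuous.
- by rewrite -oppr0; apply: cvgN; exact: cvgr_expR.
- by move=> x _; apply: derivableN; apply: ex_derive.
- apply: cvg_at_right_filter; apply: cvgN.
  apply: (@continuous_comp _ _ _ (fun t : R => - t) expR); last exact: continuous_expR.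
  exact: opp_continuous.
- move=> x _.
  by rewrite derive1E derive_val mulrN1 opprK.
Qed.

(** A divergent integral would give [Gamma] the value 0, so finiteness has to be proved too. The
    lower bound comes from [[1, 2]]; the upper bounds are t^(a-1) on []0, 1]] and e^(-t) beyond
    1. *)
Lemma Gamma_gt0 (a : R) : 0 < a < 1 -> 0 < Gamma a.
Proof.
move=> /andP[a0 a1].
have mf (D : set R) : measurable_fun D (fun t : R => (t `^ (a - 1) * expR (- t))%:E).
  apply/measurable_EFinP/measurable_funTS/measurable_funM; first exact: measurable_powR.
  by apply: measurableT_comp => //; exact: measurable_oppr.
set f := fun t : R => (t `^ (a - 1) * expR (- t))%:E.
have f0 t : (0 <= f t)%E by rewrite lee_fin mulr_ge0 ?powR_ge0 ?expR_ge0.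
apply: fine_gt0; apply/andP; split.
- apply: (@lt_le_trans _ _ (\int[mu]_(t in `[1%R, 2%R]) (cst (2 `^ (a - 1) * expR (- 2))%:E t))%E).
    rewrite integral_cst//= lebesgue_measure_itv/= lte_fin ltr1n.
    by rewrite -EFinD -EFinM lte_fin mulr_gt0// ?mulr_gt0 ?powR_gt0 ?expR_gt0//; lra.
  apply: (@le_trans _ _ (\int[mu]_(t in `[1%R, 2%R]) (f t))%E).
    apply: ge0_le_integral => //.
    - by move=> t _; rewrite lee_fin mulr_ge0 ?powR_ge0 ?expR_ge0.
    - exact: mf.
    - move=> t /=; rewrite in_itv/= => /andP[t1 t2].
      rewrite lee_fin ler_pM ?powR_ge0 ?expR_ge0//.
        by apply: powR_neg_le => //; lra.
      by rewrite ler_expR lerN2.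
  apply: ge0_subset_integral => //; first exact: mf.
  by move=> t /=; rewrite !in_itv/= andbT => /andP[t1 _]; exact: lt_le_trans t1.
- have -> : `]0%R, +oo[%classic = `]0%R, 1%R] `|` `]1%R, +oo[ :> set R.
    by rewrite -itv_bndbnd_setU// bnd_simp.
  rewrite ge0_integral_setU//; last 3 first.
  - exact: mf.
  - by move=> t _; exact: f0.
  - apply/disj_setPS => t [] /=; rewrite !in_itv/= andbT => /andP[_ t1] t1'.
    by move: (le_lt_trans t1 t1'); rewrite ltxx.
  apply: lte_add_pinfty.
    apply: le_lt_trans (ltry (1 `^ a / a)); apply: le_trans (integral_kern_le a0 ltr01).
    apply: ge0_le_integral => //.
    + by move=> t _; exact: f0.
    + exact: mf.
    + by apply/measurable_EFinP/measurable_funTS; exact: measurable_kern.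
    + move=> t /=; rewrite in_itv/= => /andP[t0 _]; rewrite lee_fin kern_pos//.
      by rewrite ler_piMr ?powR_ge0// -expR0 ler_expR oppr_le0 ltW.
  apply: le_lt_trans integral_expRN_lty.
  have me (D : set R) : measurable_fun D (fun t : R => (expR (- t))%:E).
    apply/measurable_EFinP/measurable_funTS.
    by apply: measurableT_comp => //; exact: measurable_oppr.
  apply: (@le_trans _ _ (\int[mu]_(t in `]1%R, +oo[) (expR (- t))%:E)%E).
    apply: ge0_le_integral => //.
    + by move=> t _; exact: f0.
    + exact: mf.
    + exact: me.
    + move=> t /=; rewrite in_itv/= andbT => t1; rewrite lee_fin.
      rewrite ler_piMl ?expR_ge0//.
      have := @powR_neg_le _ (a - 1) 1 t; rewrite powR1; apply => //; lra.
  apply: ge0_subset_integral => //.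
  - exact: me.
  - by move=> t /=; rewrite !in_itv/= !andbT => /ltW; exact: le_trans.
Qed.

(** The integral of |h| over a set is small once its measure is small; the set is the union of the
    given intervals, whose measure is the sum of their lengths. *)
Lemma absolutely_continuous_integral (T : R) (h : R -> R) :
  mu.-integrable `[0, T] (EFin \o h) ->
  absolutely_continuous 0 T (fun t => \int[mu]_(s in `[0, t]) h s).
Proof.
move=> ih e e0.
have ih' : mu.-integrable [set: R] (EFin \o (h \_ `[0, T])).
  by rewrite -restrict_EFin -integrable_mkcond.
have [d [d0 hd]] := integral_normr_continuous ih' e0.
exists d => // n u v uv tr sd.
pose A := \big[setU/set0]_(i < n) `]u i, v i[%classic.
have mA : measurable A by exact: bigsetU_measurable.
have muA : (mu A < d%:E)%E.
  rewrite measure_semi_additive_ord//.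
  apply: le_lt_trans (_ : ((\sum_(i < n) (v i - u i))%:E < d%:E)%E); last by rewrite lte_fin.
  rewrite -sumEFin le_eqVlt; apply/orP; left; apply/eqP; apply: eq_bigr => i _.
  transitivity (mu `]u i, v i[%classic) => //; rewrite lebesgue_measure_itv/= lte_fin.
  by have [_ -> _] := uv i.
apply: le_lt_trans (hd A mA muA).
have AT : A `<=` `[0, T].
  rewrite /A; elim/big_ind: _ => [//|B C BT CT|i _]; first by rewrite subUset.
  have [u0 _ vT] := uv i; move=> s /=; rewrite !in_itv/= => /andP[us sv].
  by rewrite (le_trans u0 (ltW us)) (le_trans (ltW sv) vT).
have inorm : mu.-integrable [set: R] (EFin \o (fun s => `|(h \_ `[0, T]) s|)).
  by have /integrable_norm := ih'.
have -> : \int[mu]_(s in A) `|(h \_ `[0, T]) s| =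
    \sum_(i < n) \int[mu]_(s in `]u i, v i[) `|(h \_ `[0, T]) s|.
  rewrite /Rintegral integral_bigsetU_EFin//=; last 3 first.
  - exact: index_enum_uniq.
  - by apply: sub_trivIset tr.
  - by apply: measurable_funTS; exact: (measurable_int mu inorm).
  rewrite (eq_bigr (fun i => (\int[mu]_(s in `]u i, v i[) `|(h \_ `[0, T]) s|)%:E)).
    by rewrite sumEFin.
  move=> i _; rewrite fineK//; apply: integrable_fin_num => //.
  exact: integrableS inorm.
apply: ler_sum => i _; have [u0 uvi vT] := uv i.
have ihv : mu.-integrable `[0, v i] (EFin \o h).
  apply: integrableS ih => // s /=; rewrite !in_itv/= => /andP[-> sv].
  exact: le_trans vT.
have ihuv : mu.-integrable `]u i, v i[ (EFin \o h).
  apply: integrableS ih => // s /=; rewrite !in_itv/= => /andP[us sv].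
  by rewrite (le_trans u0 (ltW us)) (le_trans (ltW sv) vT).
rewrite Rintegral_itvB ?bnd_simp// ?(ltW uvi)//.
rewrite -Rintegral_itv_bndo_bndc//.
apply: (le_trans (le_normr_Rintegral _ ihuv)) => //.
rewrite le_eqVlt; apply/orP; left; apply/eqP; apply: eq_Rintegral => s.
rewrite inE/= in_itv/= => /andP[us sv]; rewrite patchE mem_setE in_itv/=.
by rewrite (le_trans u0 (ltW us)) (le_trans (ltW sv) vT).
Qed.

Lemma integral0_continuous_eq0 (h : R -> R) :
  (forall T, mu.-integrable `[0, T] (EFin \o h)) ->
  (forall t, 0 < t -> \int[mu]_(s in `[0, t]) h s = 0) ->
  forall t, 0 < t -> {for t, continuous h} -> h t = 0.
Proof.
move=> ih h0 t t0 ch.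
have tt1 : t < t + 1 by rewrite ltrDl.
have [_ <-] := continuous_FTC1_closed tt1 (ih _) t0 ch.
rewrite derive1E (@near_eq_derive _ _ _ _ (cst 0)) ?derive_cst//.
by near=> s; apply: h0; near: s; exact: lt_nbhsr.
Unshelve. all: by end_near. Qed.

End PositivePart.

(** * Abel integrals of sources bounded by s^(b-1) times an L^p weight *)

Section WeightedSource.
Context {R : realType}.
Local Notation mu := (@lebesgue_measure R).

Lemma norm_Rintegral_le (f : R -> R) (A : R) : measurable_fun [set: R] f ->
  (\int[mu]_s `|f s|%:E <= A%:E)%E ->
  mu.-integrable [set: R] (EFin \o f) /\ `|\int[mu]_s f s| <= A.
Proof.
move=> mf fA.
have fi : mu.-integrable [set: R] (EFin \o f).
  apply/integrableP; split; first exact/measurable_EFinP.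
  exact: le_lt_trans (ltry A).
split=> //; rewrite -lee_fin EFin_normr_Rintegral//.
apply: le_trans fA; apply: le_abse_integral => //; exact: (measurable_int mu fi).
Qed.

Lemma integrable_beta_reflect (a t : R) : 0 < a < 1 ->
  mu.-integrable [set: R] (fun s => (kern (1 - a) (t - s) * kern a s)%:E).
Proof.
move=> a01; apply/integrableP; split.
  apply/measurable_EFinP; exact: measurable_beta_integrand.
under eq_integral => u _ do rewrite /= ger0_norm ?mulr_ge0 ?kern_ge0//.
have [t0|t0] := ltP 0 t; first by rewrite beta_scale// ltry.
rewrite integral0_eq ?ltry// => s _; have [s0|s0] := leP s 0.
  by rewrite (kern_npos _ s0) mulr0.
by rewrite kern_npos ?mul0r//; lra.
Qed.

Lemma integrable_kern_itv (a T : R) : 0 < a ->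
  mu.-integrable `[0, T] (fun s => (kern a s)%:E).
Proof.
move=> a0; have [T0|T0] := ltP 0 T; last first.
  have : mu.-integrable `[0, T] (EFin \o cst (0 : R)) by exact: integrable0.
  apply: eq_integrable => // s; rewrite inE/= in_itv/= => /andP[_ sT].
  by rewrite kern_npos// (le_trans sT).
apply/integrableP; split.
  by apply/measurable_EFinP; apply: measurable_funTS; exact: measurable_kern.
under eq_integral => u _ do rewrite /= ger0_norm ?kern_ge0//.
rewrite -integral_itv_obnd_cbnd.
  by apply: (le_lt_trans (integral_kern_le a0 T0)); rewrite ltry.
by apply/measurable_EFinP; apply: measurable_funTS; exact: measurable_kern.
Qed.

(* All that the estimates need to know about a weight G in L^p: see [holder_bound]. *)
Definition weight_bound (a T C : R) (G : R -> R) := [/\ measurable_fun [set: R] G,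
  0 <= C, (\int[mu]_s (kern a s * `|G s|)%:E <= C%:E)%E &
  forall t, t <= T -> (\int[mu]_s (kern a (t - s) * `|G s|)%:E <= C%:E)%E].

Variables (a b : R).
Hypotheses (b01 : 0 < b < 1) (ab : a < b).

Lemma conv_norm_bound (T C N lam m t : R) (G h : R -> R) :
  weight_bound a T C G -> measurable_fun [set: R] h ->
  (forall s, s <= 0 -> h s = 0) -> 0 <= N ->
  (forall s, 0 < s <= T -> `|h s| <= N * (kern b s * expR (lam * s) * `|G s|)) ->
  0 < t -> t <= T -> 0 <= lam -> 0 <= m ->
  (forall u, 0 < u < t -> u `^ (b - a) * expR (- (lam * u)) <= m) ->
  (\int[mu]_s `|kern b (t - s) * h s|%:E <=
   (N * expR (lam * t) * (2 * t `^ (b - 1) * m * (C + C)))%:E)%E.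
Proof.
move=> [mG C0 GC GCr] mh h0 N0 hN t0 tT lam0 m0 hm.
have NE0 : 0 <= N * expR (lam * t) by rewrite mulr_ge0 ?expR_ge0.
have mW := measurable_conv_weight b mG lam t.
apply: (@le_trans _ _ (\int[mu]_s ((N * expR (lam * t))%:E *
    (kern b (t - s) * kern b s * expR (- (lam * (t - s))) * `|G s|)%:E))%E).
  apply: ge0_le_integral => //.
  - by apply/measurable_EFinP/measurableT_comp => //; apply: measurable_funM;
      [exact: measurable_kern_refl|].
  - by apply: measurable_funeM; exact/measurable_EFinP.
  - move=> s _; rewrite -EFinM lee_fin normrM (ger0_norm (kern_ge0 _ _)).
    have rhs0 : 0 <= kern b (t - s) * kern b s * expR (- (lam * (t - s))) * `|G s|.
      by rewrite !mulr_ge0 ?kern_ge0 ?expR_ge0.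
    have [s0|s0] := leP s 0; first by rewrite h0// normr0 mulr0 mulr_ge0.
    have [ts|st] := leP t s; first by rewrite kern_npos ?mul0r ?mulr_ge0// subr_le0.
    have sT : 0 < s <= T by rewrite s0 (le_trans (ltW st)).
    apply: (le_trans (ler_wpM2l (kern_ge0 _ _) (hN s sT))).
    (* This extracts the weight e^(lam t) of the norm at [t] and leaves decay in the distance t - s,
       where [conv_bound] can use it. *)
    have -> : expR (lam * s) = expR (lam * t) * expR (- (lam * (t - s))).
      by rewrite -expRD; congr expR; ring.
    by rewrite le_eqVlt; apply/orP; left; apply/eqP; ring.
rewrite ge0_integralZl//; last 2 first.
  - exact/measurable_EFinP.
  - by move=> s _; rewrite lee_fin !mulr_ge0 ?kern_ge0 ?expR_ge0.
rewrite [leRHS]EFinM lee_wpmul2l ?lee_fin//.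
by apply: conv_bound GC GCr _ _ _ _ _ _ _ _ => //.
Qed.

Lemma abel_norm_bound (T C N lam m t : R) (G h : R -> R) :
  weight_bound a T C G -> measurable_fun [set: R] h ->
  (forall s, s <= 0 -> h s = 0) -> 0 <= N ->
  (forall s, 0 < s <= T -> `|h s| <= N * (kern b s * expR (lam * s) * `|G s|)) ->
  0 < t -> t <= T -> 0 <= lam -> 0 <= m ->
  (forall u, 0 < u < t -> u `^ (b - a) * expR (- (lam * u)) <= m) ->
  mu.-integrable [set: R] (fun s => (kern b (t - s) * h s)%:E) /\
  `|abel b h t| <= N * expR (lam * t) * (2 * t `^ (b - 1) * m * (C + C)).
Proof.
move=> GC mh h0 N0 hN t0 tT lam0 m0 hm; apply: norm_Rintegral_le.
  by apply: measurable_funM => //; exact: measurable_kern_refl.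
exact: (conv_norm_bound GC).
Qed.

Variable h : R -> R.
Hypotheses (mh : measurable_fun [set: R] h) (h0 : forall s, s <= 0 -> h s = 0).
Hypothesis hw : forall T, 0 < T -> exists G C N, [/\ weight_bound a T C G, 0 <= N &
  forall s, 0 < s <= T -> `|h s| <= N * (kern b s * `|G s|)].

(** The case lam = 0, m = t^(b-a) of [abel_norm_bound]. The surplus t^(b-a) makes the Abel integral
    negligible against t^(b-1) at 0. *)
Lemma weighted_abel T : 0 < T -> exists2 M, 0 <= M & forall t, 0 < t <= T ->
  mu.-integrable [set: R] (fun s => (kern b (t - s) * h s)%:E) /\
  `|abel b h t| <= M * (t `^ (b - a) * t `^ (b - 1)).
Proof.
move=> T0; have [G [C [N [GC N0 hN]]]] := hw T0.
have C0 : 0 <= C by case: GC.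
exists (4 * N * C); first by rewrite !mulr_ge0.
move=> t /andP[t0 tT].
have [|u /andP[u0 ut]|ib le] := abel_norm_bound (lam := 0) (m := t `^ (b - a)) GC mh h0
  N0 _ t0 tT (lexx 0) (powR_ge0 _ _) _.
- by move=> s sT; rewrite mul0r expR0 mulr1 hN.
- by rewrite mul0r oppr0 expR0 mulr1; apply: ge0_ler_powR; rewrite ?nnegrE ?subr_ge0 ltW.
split=> //; apply: (le_trans le); rewrite mul0r expR0 mulr1.
by rewrite le_eqVlt; apply/orP; left; apply/eqP; ring.
Qed.

Lemma weighted_integrable_conv t :
  mu.-integrable [set: R] (fun s => (kern b (t - s) * h s)%:E).
Proof.
have [t0|t0] := ltP 0 t.
  have [M _ /(_ t)] := weighted_abel t0; rewrite t0 lexx => /(_ isT)[]//.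
have -> : (fun s => (kern b (t - s) * h s)%:E) = cst 0%E; last exact: integrable0.
apply/funext => s; have [s0|s0] := leP s 0; first by rewrite h0// mulr0.
by rewrite kern_npos ?mul0r//; lra.
Qed.

Lemma weighted_integrable_itv T : mu.-integrable `[0, T] (fun s => (h s)%:E).
Proof.
have [T0|T0] := ltP 0 T; last first.
  have : mu.-integrable `[0, T] (EFin \o cst (0 : R)) by exact: integrable0.
  apply: eq_integrable => // s; rewrite inE/= in_itv/= => /andP[_ sT].
  by rewrite h0// (le_trans sT).
have [G [C [N [[mG C0 GC _] N0 hN]]]] := hw T0.
have iG : mu.-integrable `[0, T] (fun s => (kern a s * `|G s|)%:E).
  apply: integrableS (_ : mu.-integrable [set: R] _) => //.
  apply/integrableP; split.
    apply/measurable_EFinP; apply: measurable_funM; first exact: measurable_kern.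
    exact: measurableT_comp.
  under eq_integral => s _ do rewrite /= ger0_norm ?mulr_ge0 ?kern_ge0//.
  exact: le_lt_trans (ltry C).
have := integrable_scale (N * T `^ (b - a)) (measurable_itv `[0, T]) iG.
apply: le_integrable => //.
  by apply/measurable_EFinP; exact: measurable_funTS.
move=> s /=; rewrite in_itv/= => /andP[s0 sT]; rewrite lee_fin.
have rhs0 : 0 <= N * T `^ (b - a) * (kern a s * `|G s|).
  by rewrite !mulr_ge0 ?kern_ge0 ?powR_ge0.
rewrite [leRHS]ger0_norm//; move: s0; rewrite le_eqVlt => /predU1P[s0|s0].
  by rewrite h0 ?normr0// -s0.
apply: (le_trans (hN s _)); first by rewrite s0.
rewrite -mulrA ler_wpM2l// mulrA ler_wpM2r// !kern_pos//.
have -> : b - 1 = (b - a) + (a - 1) by ring.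
rewrite powRD; last by apply/implyP => _; rewrite gt_eqF.
by rewrite ler_wpM2r ?powR_ge0//; apply: ge0_ler_powR; rewrite ?nnegrE ?subr_ge0// ltW//.
Qed.

Hypothesis ch : forall s, 0 < s -> {for s, continuous h}.

Lemma weighted_abel_continuous t : 0 < t -> {for t, continuous (abel b h)}.
Proof.
apply: continuous_abel => //.
- exact: weighted_integrable_itv.
- exact: weighted_integrable_conv.
Qed.

Lemma weighted_abel_pospart : pospart (abel b h) = abel b h.
Proof.
apply/funext => t; have [t0|t0] := ltP 0 t; first by rewrite pospart_gt0.
by rewrite pospart_le0// abel_npos.
Qed.

(** The factor [betaI b] comes from two sources: scale invariance for the transform of [kern b], and
    [abel_comp] for the transform of [abel b h]. *)
Lemma weighted_abel_comp (x0 c t : R) : 0 < t ->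
  abel (1 - b) (fun s => x0 * kern b s + c * abel b h s) t =
  betaI b * (x0 + c * \int[mu]_(s in `[0, t]) h s).
Proof.
move=> t0.
have mab : measurable_fun [set: R] (abel b h).
  by rewrite -weighted_abel_pospart; apply: measurable_pospart; exact: weighted_abel_continuous.
have i1 : mu.-integrable [set: R] (EFin \o (fun s => kern (1 - b) (t - s) * kern b s)).
  exact: integrable_beta_reflect.
(* On []0, t]], [weighted_abel] bounds [abel b h] by a constant times [kern b], so the Beta
   integrand dominates. *)
have i2 : mu.-integrable [set: R] (EFin \o (fun s => kern (1 - b) (t - s) * abel b h s)).
  have [M M0 hM] := weighted_abel t0.
  have := integrable_scale (M * t `^ (b - a)) measurableT i1.
  apply: le_integrable => //.
    by apply/measurable_EFinP/measurable_funM => //; exact: measurable_kern_refl.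
  move=> s _ /=; rewrite lee_fin normrM (ger0_norm (kern_ge0 _ _)).
  have rhs0 : 0 <= M * t `^ (b - a) * (kern (1 - b) (t - s) * kern b s).
    by rewrite !mulr_ge0 ?kern_ge0 ?powR_ge0.
  rewrite [leRHS]ger0_norm//.
  have [s0|s0] := leP s 0; first by rewrite abel_npos// normr0 mulr0.
  have [ts|st] := leP t s; first by rewrite (@kern_npos _ _ (t - s)) ?subr_le0// !mul0r mulr0.
  have [|_ le] := hM s; first by rewrite s0 ltW.
  rewrite [leRHS]mulrCA ler_wpM2l ?kern_ge0//; apply: (le_trans le).
  rewrite -mulrA ler_wpM2l// kern_pos// ler_wpM2r ?powR_ge0//.
  by apply: ge0_ler_powR; rewrite ?nnegrE ?subr_ge0 ltW.
have kb : abel (1 - b) (kern b) t = betaI b.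
  by rewrite /abel /Rintegral beta_scale.
have ka : abel (1 - b) (abel b h) t = betaI b * \int[mu]_(s in `[0, t]) h s.
  by apply: (abel_comp b01 mh h0 (weighted_integrable_itv t)); exact: weighted_integrable_conv.
have -> : betaI b * (x0 + c * \int[mu]_(s in `[0, t]) h s) =
    x0 * abel (1 - b) (kern b) t + c * abel (1 - b) (abel b h) t by rewrite kb ka; ring.
transitivity (\int[mu]_s (x0 * (kern (1 - b) (t - s) * kern b s) +
    c * (kern (1 - b) (t - s) * abel b h s))).
  by apply: eq_Rintegral => s _; ring.
have j1 := integrable_scale x0 measurableT i1.
have j2 := integrable_scale c measurableT i2.
by rewrite (RintegralD measurableT j1 j2) (RintegralZl x0 measurableT i1)
  (RintegralZl c measurableT i2).
Qed.

End WeightedSource.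

(** * Picard iteration in the weighted norm *)

Section WeightedContinuous.
Context {R : realType}.
Local Notation mu := (@lebesgue_measure R).
Variable b : R.

(** Only a bound on t^(1-b) x(t) is required near 0, with a constant depending on [T]; such bounds
    pass to limits of the iteration directly, which a limit condition at 0 would not. *)
Definition wcont (x : R -> R) := (forall s, 0 < s -> {for s, continuous x}) /\
  forall T, 0 < T -> exists2 M, 0 <= M & forall s, 0 < s <= T -> `|x s| <= M * kern b s.

Lemma geometric_lt (A e : R) : 0 < e -> exists n, A * (2^-1) ^+ n < e.
Proof.
move=> e0; have : geometric A (2^-1 : R) @ \oo --> 0.
  by apply: cvg_geometric; rewrite ger0_norm// invf_lt1// ltr1n.
move=> /cvgrPdist_lt /(_ e e0) [n _ /(_ n (leqnn n)) hn]; exists n.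
by move: hn; rewrite sub0r normrN; apply: le_lt_trans; exact: ler_norm.
Qed.

Section PicardIteration.
Variable P : (R -> R) -> R -> R.
Hypothesis P_wcont : forall x, wcont x -> wcont (P x).
(** The rate [lam] depends on [T], so there is no single norm on the half-line. The iteration
    converges pointwise, with estimates on each []0, T]]. *)
Hypothesis P_contract : forall T, 0 < T -> exists2 lam, 0 <= lam &
  forall x y N, wcont x -> wcont y -> 0 <= N ->
  (forall s, 0 < s <= T -> `|x s - y s| <= N * (kern b s * expR (lam * s))) ->
  forall s, 0 < s <= T -> `|P x s - P y s| <= N / 2 * (kern b s * expR (lam * s)).

Lemma wcont_sub (x y : R -> R) T lam : wcont x -> wcont y -> 0 < T -> 0 <= lam ->
  exists2 N, 0 <= N &
  forall s, 0 < s <= T -> `|x s - y s| <= N * (kern b s * expR (lam * s)).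
Proof.
move=> [_ /(_ T)xM] [_ /(_ T)yM] T0 lam0.
have [M1 M10 {}xM] := xM T0; have [M2 M20 {}yM] := yM T0.
exists (M1 + M2); first exact: addr_ge0.
move=> s sT; have /andP[s0 _] := sT.
apply: (le_trans (ler_normB _ _)); apply: (le_trans (lerD (xM s sT) (yM s sT))).
rewrite -mulrDl ler_wpM2l ?addr_ge0// ler_peMr ?kern_ge0//.
by rewrite -expR0 ler_expR mulr_ge0// ltW.
Qed.

Lemma fixpoint_unique (x y : R -> R) : wcont x -> wcont y ->
  (forall t, 0 < t -> x t = P x t) -> (forall t, 0 < t -> y t = P y t) ->
  forall t, 0 < t -> x t = y t.
Proof.
move=> wx wy Px Py t t0; have [lam lam0 contr] := P_contract t0.
have [N N0 xyN] := wcont_sub wx wy t0 lam0.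
have step n : forall s, 0 < s <= t ->
    `|x s - y s| <= N * (2^-1) ^+ n * (kern b s * expR (lam * s)).
  elim: n => [|n IH] s st; first by rewrite expr0 mulr1 xyN.
  have /andP[s0 _] := st; rewrite Px// Py// exprSr [N * _]mulrA.
  by apply: contr => //; rewrite mulr_ge0// exprn_ge0.
apply/eqP; rewrite -subr_eq0 -normr_le0; apply/ler_addgt0Pr => e e0; rewrite add0r.
have [n le_e] := geometric_lt (N * (kern b t * expR (lam * t))) e0.
apply/ltW/(le_lt_trans _ le_e); rewrite mulrAC; apply: step; rewrite t0 lexx//.
Qed.

Variable u0 : R -> R.
Hypothesis u0_wcont : wcont u0.

Let u n := iter n P u0.

Let u_wcont n : wcont (u n).
Proof. by elim: n => [//|n IH]; exact: P_wcont. Qed.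

(** The contraction property is repeated in the conclusion because later steps need it for this same
    [lam]. *)
Let u_cauchy T : 0 < T -> exists lam N, [/\ 0 <= lam, 0 <= N,
  (forall n k s, 0 < s <= T ->
    `|u (n + k) s - u n s| <= N * (2^-1) ^+ n * (kern b s * expR (lam * s))) &
  forall x y N, wcont x -> wcont y -> 0 <= N ->
  (forall s, 0 < s <= T -> `|x s - y s| <= N * (kern b s * expR (lam * s))) ->
  forall s, 0 < s <= T -> `|P x s - P y s| <= N / 2 * (kern b s * expR (lam * s))].
Proof.
move=> T0; have [lam lam0 contr] := P_contract T0.
have [N N0 h01] := wcont_sub (u_wcont 1) (u_wcont 0) T0 lam0.
exists lam, (2 * N); split => //; first by rewrite mulr_ge0.
have step n : forall s, 0 < s <= T ->
    `|u n.+1 s - u n s| <= N * (2^-1) ^+ n * (kern b s * expR (lam * s)).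
  elim: n => [|n IH] s sT; first by rewrite expr0 mulr1 h01.
  rewrite exprSr [N * _]mulrA;  apply: (contr (u n.+1) (u n)) => //. by rewrite mulr_ge0 ?exprn_ge0.
move=> n k s sT.
have w0 : 0 <= kern b s * expR (lam * s) by rewrite mulr_ge0 ?kern_ge0 ?expR_ge0.
(* The sharper bound makes the induction on [k] close: 2^(-m) = 2 (2^(-m) - 2^(-m-1)), so the steps
   telescope. This is where the constant 2N comes from. *)
suff : `|u (n + k) s - u n s| <=
    2 * N * ((2^-1) ^+ n - (2^-1) ^+ (n + k)) * (kern b s * expR (lam * s)).
  move/le_trans; apply; rewrite ler_wpM2r// ler_wpM2l ?mulr_ge0//.
  by rewrite gerBl exprn_ge0.
elim: k => [|k IH]; first by rewrite addn0 !subrr normr0 mulr0 mul0r.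
rewrite addnS (_ : u _ s - u n s = (u (n + k).+1 s - u (n + k) s) + (u (n + k) s - u n s)).
  apply: (le_trans (ler_normD _ _)); apply: (le_trans (lerD (step _ _ sT) IH)).
  by rewrite le_eqVlt; apply/orP; left; apply/eqP; rewrite exprSr; field.
by rewrite addrA subrK.
Qed.

Let U t : R := lim (u n t @[n --> \oo]).

Let U_close T : 0 < T -> exists lam N, [/\ 0 <= lam, 0 <= N,
  (forall n s, 0 < s <= T ->
    `|U s - u n s| <= N * (2^-1) ^+ n * (kern b s * expR (lam * s))) &
  forall x y N, wcont x -> wcont y -> 0 <= N ->
  (forall s, 0 < s <= T -> `|x s - y s| <= N * (kern b s * expR (lam * s))) ->
  forall s, 0 < s <= T -> `|P x s - P y s| <= N / 2 * (kern b s * expR (lam * s))].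
Proof.
move=> T0; have [lam [N [lam0 N0 hN contr]]] := u_cauchy T0.
exists lam, N; split => // n s sT.
have cu : cvgn (fun n => u n s).
  apply: cauchy_cvg; apply: cauchy_exP => e e0.
  have [m hm] := geometric_lt (N * (kern b s * expR (lam * s))) e0.
  exists (u m s); exists m => // k /= mk; rewrite /ball /= distrC.
  apply: le_lt_trans hm; rewrite -(subnKC mk) mulrAC; exact: hN.
apply/ler_addgt0Pr => e e0.
move/cvgrPdist_lt : cu => /(_ e e0) [m _ /(_ (n + m)%N (leq_addl _ _))] hm.
rewrite (_ : U s - u n s = (U s - u (n + m) s) + (u (n + m) s - u n s)); last first.
  by rewrite addrA subrK.
by rewrite addrC (le_trans (ler_normD _ _))// lerD ?hN// ltW.
Qed.

Let weight_le lam s t T : 0 < b < 1 -> 0 <= lam -> 0 < s -> s <= t -> t <= T ->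
  kern b t * expR (lam * t) <= kern b s * expR (lam * T).
Proof.
move=> b01 lam0 s0 st tT; rewrite ler_pM ?kern_ge0 ?expR_ge0//.
  rewrite !kern_pos//; last exact: lt_le_trans st.
  by apply: powR_neg_le => //; lra.
by rewrite ler_expR ler_wpM2l.
Qed.

Let U_wcont : 0 < b < 1 -> wcont U.
Proof.
move=> b01; split=> [s s0|T T0].
  apply/cvgrPdist_le => e e0; have s10 : 0 < s + 1 by rewrite addr_gt0.
  have [lam [N [lam0 N0 hN _]]] := U_close s10.
  (* [W] dominates the weight on all of [[s/2, s+1]], since the kernel decreases and the exponential
     increases. Convergence is thus uniform near [s], and three errors of e/3 give continuity of the
     limit. *)
  pose W := kern b (s / 2) * expR (lam * (s + 1)).
  have e30 : 0 < e / 3 by rewrite divr_gt0.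
  have [n hn] := geometric_lt (N * W) e30.
  have close t : s / 2 <= t -> t <= s + 1 -> `|U t - u n t| <= e / 3.
    move=> st ts; have t0 : 0 < t by apply: lt_le_trans st; rewrite divr_gt0.
    apply: ltW; apply: le_lt_trans hn.
    apply: (le_trans (hN n t _)); first by rewrite t0 ts.
    rewrite [leRHS]mulrAC ler_wpM2l ?mulr_ge0 ?exprn_ge0//.
    by apply: weight_le => //; rewrite divr_gt0.
  have [cu _] := u_wcont n.
  have /cvgrPdist_le /(_ _ e30) hu := cu s s0.
  near=> t.
  have ts1 : s / 2 <= t by apply: ltW; near: t; apply: lt_nbhsr; lra.
  have ts2 : t <= s + 1 by apply: ltW; near: t; apply: lt_nbhsl; lra.
  have ut : `|u n s - u n t| <= e / 3 by near: t; exact: hu.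
  have Us : `|U s - u n s| <= e / 3.
    by apply: close; rewrite ?lerDl// ler_pdivrMr// ler_peMr ?ler1n// ltW.
  have Ut := close t ts1 ts2.
  have -> : U s - U t = (U s - u n s) + (u n s - u n t) - (U t - u n t) by ring.
  apply: (le_trans (ler_normB _ _)).
  rewrite [e](_ : _ = e / 3 + e / 3 + e / 3); last by field.
  by apply: lerD => //; apply: (le_trans (ler_normD _ _)); exact: lerD.
have [lam [N [lam0 N0 hN _]]] := U_close T0.
have [_ /(_ T T0) [M M0 hM]] := u_wcont 0.
exists (M + N * expR (lam * T)); first by rewrite addr_ge0// mulr_ge0 ?expR_ge0.
move=> s sT; rewrite -(subrK (u 0 s) (U s)) addrC.
apply: (le_trans (ler_normD _ _)); rewrite mulrDl lerD ?hM//.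
apply: (le_trans (hN 0%N s sT)); rewrite expr0 mulr1 -mulrA ler_wpM2l//.
have /andP[s0 sT'] := sT; rewrite [leRHS]mulrC ler_wpM2l ?kern_ge0//.
by rewrite ler_expR ler_wpM2l.
Unshelve. all: by end_near. Qed.

Lemma fixpoint_exists : 0 < b < 1 -> exists2 x, wcont x & forall t, 0 < t -> x t = P x t.
Proof.
move=> b01; exists U; first exact: U_wcont.
move=> t t0; have [lam [N [lam0 N0 hN contr]]] := U_close t0.
apply/eqP; rewrite -subr_eq0 -normr_le0; apply/ler_addgt0Pr => e e0; rewrite add0r.
have [n le_e] := geometric_lt (N * (kern b t * expR (lam * t))) e0.
apply/ltW/(le_lt_trans _ le_e).
have -> : U t - P U t = (U t - u n.+1 t) + (P (u n) t - P U t) by rewrite addrA subrK.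
have tt : 0 < t <= t by rewrite t0 lexx.
apply: (le_trans (ler_normD _ _)).
apply: (le_trans (lerD (hN n.+1 t tt) (contr (u n) U (N * 2^-1 ^+ n) _ _ _ _ t tt))) => //.
- exact: U_wcont.
- by rewrite mulr_ge0// exprn_ge0.
- by move=> s st; rewrite distrC; exact: hN.
- by rewrite le_eqVlt; apply/orP; left; apply/eqP; rewrite exprSr; field.
Qed.

End PicardIteration.
End WeightedContinuous.

(** * The fractional differential equation *)

Section Problem.
Context {R : realType}.
Local Notation mu := (@lebesgue_measure R).
Variables (b x0 p : R) (f : R -> R -> R) (l : R -> R).
Hypotheses (hb : 0 < b < 1) (hp : b^-1 < p).
Hypothesis hf : {within [set tx : R * R | 0 < tx.1],
  continuous (fun tx : R * R => f tx.1 tx.2)}.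
Hypothesis hlip : forall t x y : R, 0 < t -> `|f t x - f t y| <= l t * `|x - y|.
Hypothesis hlp : Lp_loc p l.
Hypothesis hf0 : Lp_loc p (fun t => t `^ (1 - b) * `|f t 0|).

Let b0 : 0 < b. Proof. by case/andP: hb. Qed.
Let b1 : b < 1. Proof. by case/andP: hb. Qed.
Let hb' : 0 < 1 - b < 1. Proof. by have := b0; have := b1; lra. Qed.
Let p1 : 1 < p.
Proof. by apply: lt_trans hp; rewrite invf_gt1. Qed.

(* Any exponent between 1/p and b would do: the gap b - a produces the contraction. *)
Let a : R := (p^-1 + b) / 2.

Let pVb : p^-1 < b.
Proof. by rewrite -[ltRHS]invrK ltf_pV2 ?posrE ?invr_gt0// (lt_trans ltr01). Qed.
Let pV0 : 0 < p^-1. Proof. by rewrite invr_gt0 (lt_trans ltr01). Qed.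
Let ab : a < b. Proof. by rewrite /a; have := pVb; lra. Qed.
Let a01 : 0 < a < 1.
Proof. by rewrite /a; have := pVb; have := pV0; have := b1; lra. Qed.
Let ap : a^-1 < p.
Proof.
have /andP[a0 _] := a01.
rewrite -[ltRHS]invrK ltf_pV2 ?posrE//; rewrite /a; have := pVb; lra.
Qed.

Lemma Lp_loc_weight (g : R -> R) T : Lp_loc p g -> 0 < T ->
  exists C, weight_bound a T C (g \_ `[0, T]).
Proof.
move=> gp T0; have gT := gp T T0.
have mg : measurable_fun [set: R] (g \_ `[0, T]).
  by move: gT; rewrite inE => /andP[/[!inE]].
have g0 s : ~~ (0 <= s <= T) -> (g \_ `[0, T]) s = 0.
  by move=> sT; rewrite patchE mem_setE in_itv/= (negbTE sT).
have gpT : (\int[mu]_s (`|(g \_ `[0%R, T]) s| `^ p)%:E < +oo)%E.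
  have /integrableP[_] := Lfun_integrable (ltW p1) gT.
  by under eq_integral => s _ do rewrite /= ger0_norm ?powR_ge0//.
have [C C0 [H1 H2]] := holder_bound p1 T0 mg g0 gpT a01 ap.
by exists C; split.
Qed.

Lemma lipschitz_ge0 t : 0 < t -> 0 <= l t.
Proof.
move=> t0; have := hlip 1 0 t0; rewrite subr0 normr1 mulr1.
exact: le_trans.
Qed.

Definition source (x : R -> R) := pospart (fun s => f s (x s)).

Lemma continuous_rhs (x : R -> R) s : 0 < s -> {for s, continuous x} ->
  {for s, continuous (fun t => f t (x t))}.
Proof.
move=> s0 cx.
have oA : open [set tx : R * R | 0 < tx.1].
  apply: (@open_comp _ _ (@fst R R) [set t | 0 < t]); last exact: open_gt.
  by move=> z _; exact: cvg_fst.
have cf : {for (s, x s), continuous (fun tx : R * R => f tx.1 tx.2)}.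
  by move: hf; rewrite continuous_open_subspace// => /(_ (s, x s)); apply; rewrite inE.
exact: (@continuous2_cvg _ _ _ _ (nbhs s) _ id x f s (x s)).
Qed.

Section Source.
Variable x : R -> R.
Hypothesis wx : wcont b x.

Lemma measurable_source : measurable_fun [set: R] (source x).
Proof.
apply: measurable_pospart => s s0; apply: continuous_rhs => //.
by case: wx => cx _; exact: cx.
Qed.

Lemma source_le0 s : s <= 0 -> source x s = 0.
Proof. exact: pospart_le0. Qed.

Lemma continuous_source s : 0 < s -> {for s, continuous (source x)}.
Proof.
move=> s0; apply: continuous_pospart => //; apply: continuous_rhs => //.
by case: wx => cx _; exact: cx.
Qed.

(** The Lipschitz bound gives |f(s,x)| <= l(s)|x| + |f(s,0)|. The first term carries [kern b]
    through |x|, the second after writing 1 = s^(b-1) s^(1-b), which is where the weight in the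
    hypothesis on f(s,0) is used. *)
Lemma source_weighted T : 0 < T -> exists G C N, [/\ weight_bound a T C G, 0 <= N &
  forall s, 0 < s <= T -> `|source x s| <= N * (kern b s * `|G s|)].
Proof.
move=> T0; have [Cl [ml Cl0 l1 l2]] := Lp_loc_weight hlp T0.
have [C0 [m0 C00 f1 f2]] := Lp_loc_weight hf0 T0.
case: wx => _ /(_ T T0) [M M0 xM].
set gl := l \_ `[0, T] in ml l1 l2; set g0 := (fun t => _) \_ `[0, T] in m0 f1 f2.
have mn (g : R -> R) : measurable_fun [set: R] g ->
    measurable_fun [set: R] (fun s => `|g s|) by move=> mg; exact: measurableT_comp.
have mG : measurable_fun [set: R] (fun s => `|gl s| + `|g0 s|).
  by apply: measurable_funD; exact: mn.
have nn s : `|(`|gl s| + `|g0 s|)| = `|gl s| + `|g0 s| by rewrite ger0_norm// addr_ge0.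
(* M + 1 dominates both coefficients: [M] in front of [l], and 1 in front of s^(1-b)|f(s,0)|. *)
exists (fun s => `|gl s| + `|g0 s|), (1 * (Cl + C0)), (M + 1); split.
- split.
  + exact: mG.
  + by rewrite mul1r addr_ge0.
  + apply: (integral_le_combination (G := fun s => kern a s * `|gl s|)
      (H := fun s => kern a s * `|g0 s|) _ _ _ _ _ _ _ _ l1 f1).
    * by apply: measurable_funM; [exact: measurable_kern|exact: mn].
    * by apply: measurable_funM; [exact: measurable_kern|exact: mn].
    * by apply: measurable_funM; [exact: measurable_kern|exact: mn].
    * exact: ler01.
    * by move=> s; rewrite mulr_ge0 ?kern_ge0.
    * by move=> s; rewrite mulr_ge0 ?kern_ge0.
    * by move=> s; rewrite mulr_ge0 ?kern_ge0.
    * by move=> s; rewrite mul1r -mulrDr nn.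
  + move=> t tT; apply: (integral_le_combination (G := fun s => kern a (t - s) * `|gl s|)
      (H := fun s => kern a (t - s) * `|g0 s|) _ _ _ _ _ _ _ _ (l2 t tT) (f2 t tT)).
    * by apply: measurable_funM; [exact: measurable_kern_refl|exact: mn].
    * by apply: measurable_funM; [exact: measurable_kern_refl|exact: mn].
    * by apply: measurable_funM; [exact: measurable_kern_refl|exact: mn].
    * exact: ler01.
    * by move=> s; rewrite mulr_ge0 ?kern_ge0.
    * by move=> s; rewrite mulr_ge0 ?kern_ge0.
    * by move=> s; rewrite mulr_ge0 ?kern_ge0.
    * by move=> s; rewrite mul1r -mulrDr nn.
- exact: addr_ge0.
- move=> s sT; have /andP[s0 sleT] := sT; rewrite nn.
  have sin : s \in `[0, T]%classic by rewrite mem_setE in_itv/= (ltW s0).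
  have -> : gl s = l s by rewrite /gl patchE sin.
  have -> : g0 s = s `^ (1 - b) * `|f s 0| by rewrite /g0 patchE sin.
  have fs0 : `|f s 0| = kern b s * `|s `^ (1 - b) * `|f s 0| |.
    rewrite normrM normr_id (ger0_norm (powR_ge0 _ _)) mulrA kern_pos// -powRD.
      by rewrite addrC subrKA subrr powRr0 mul1r.
    by apply/implyP => _; rewrite gt_eqF.
  have l0 := lipschitz_ge0 s0.
  rewrite /source pospart_gt0// -(subrK (f s 0) (f s (x s))).
  apply: (le_trans (ler_normD _ _)); rewrite {1}fs0 [kern b s * (_ + _)]mulrDr mulrDr.
  apply: lerD; last by rewrite ler_peMl ?mulr_ge0 ?kern_ge0// lerDr.
  apply: (le_trans (hlip _ _ s0)); rewrite subr0 (ger0_norm l0).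
  rewrite [leRHS](_ : _ = l s * ((M + 1) * kern b s)); last by ring.
  rewrite ler_wpM2l//; apply: (le_trans (xM s sT)).
  by rewrite ler_wpM2r ?kern_ge0// lerDl.
Qed.


Lemma abel_source_bound T : 0 < T -> exists2 M, 0 <= M & forall t, 0 < t <= T ->
  `|abel b (source x) t| <= M * (t `^ (b - a) * t `^ (b - 1)).
Proof.
move=> T0; have [M M0 hM] := weighted_abel hb ab measurable_source source_le0
  source_weighted T0.
by exists M => // t tT; have [] := hM t tT.
Qed.

Lemma continuous_abel_source t : 0 < t -> {for t, continuous (abel b (source x))}.
Proof.
move=> t0; apply: (weighted_abel_continuous hb ab measurable_source source_le0
  source_weighted) => // s; exact: continuous_source.
Qed.

End Source.

(* In place of 1 / Gamma b, which spares Euler's identity B(b, 1-b) = Gamma(b) Gamma(1-b). *)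
Definition coef : R := Gamma (1 - b) / betaI b.

Lemma betaI_gt0 : 0 < betaI b.
Proof. by rewrite (lt_le_trans ltr01)// betaI_ge1. Qed.

Lemma coef_gt0 : 0 < coef.
Proof. by rewrite divr_gt0 ?betaI_gt0// Gamma_gt0. Qed.

Definition picard (x : R -> R) (t : R) : R := x0 * kern b t + coef * abel b (source x) t.

Lemma wcont_kern : wcont b (fun t => x0 * kern b t).
Proof.
split=> [s s0|T T0].
  by apply: continuousM; [exact: cvg_cst|exact: continuous_kern].
by exists `|x0| => // s _; rewrite normrM (ger0_norm (kern_ge0 _ _)).
Qed.

Lemma picard_wcont x : wcont b x -> wcont b (picard x).
Proof.
move=> wx; have [ck kM] := wcont_kern; split=> [s s0|T T0].
  apply: (@continuousD _ _ _ (fun t => x0 * kern b t)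
    (fun t => coef * abel b (source x) t)); first exact: ck.
  by apply: continuousM; [exact: cvg_cst|exact: continuous_abel_source].
have [M1 M10 hM1] := kM T T0; have [M2 M20 hM2] := abel_source_bound wx T0.
have c0 := ltW coef_gt0.
exists (M1 + coef * (M2 * T `^ (b - a))).
  by apply: addr_ge0 => //; apply: mulr_ge0 => //; apply: mulr_ge0 => //; exact: powR_ge0.
move=> s sT; have /andP[s0 sleT] := sT.
apply: (le_trans (ler_normD _ _)); rewrite mulrDl; apply: lerD; first exact: hM1.
rewrite normrM (ger0_norm c0) -[leRHS]mulrA ler_wpM2l//.
apply: (le_trans (hM2 s sT)); rewrite -mulrA ler_wpM2l// kern_pos//.
rewrite ler_wpM2r ?powR_ge0//; apply: ge0_ler_powR; rewrite ?nnegrE ?subr_ge0//; exact: ltW.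
Qed.

Lemma picard_sub x y t : wcont b x -> wcont b y ->
  picard x t - picard y t = coef * abel b (fun s => source x s - source y s) t.
Proof.
move=> wx wy; rewrite /picard opprD addrACA subrr add0r -mulrBr; congr (_ * _).
rewrite /abel -RintegralB//.
- by apply: eq_Rintegral => s _; rewrite mulrBr.
- apply: (weighted_integrable_conv hb ab (measurable_source wx) (source_le0 x)).
  exact: source_weighted.
- apply: (weighted_integrable_conv hb ab (measurable_source wy) (source_le0 y)).
  exact: source_weighted.
Qed.

Lemma picard_contract T : 0 < T -> exists2 lam, 0 <= lam &
  forall x y N, wcont b x -> wcont b y -> 0 <= N ->
  (forall s, 0 < s <= T -> `|x s - y s| <= N * (kern b s * expR (lam * s))) ->
  forall s, 0 < s <= T ->
    `|picard x s - picard y s| <= N / 2 * (kern b s * expR (lam * s)).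
Proof.
move=> T0; have [C wC] := Lp_loc_weight hlp T0.
have C0 : 0 <= C by case: wC.
have c0 := coef_gt0; have ba0 : 0 < b - a by rewrite subr_gt0.
(* The convolution bound costs 4 coef C d, and 8 coef C d <= 1 turns this into the factor 1/2. The
   added 1 keeps the inverse meaningful when C = 0; [lam] is chosen so that lam^(a-b) = d. *)
pose d := (8 * (coef * C + 1))^-1.
have D0 : 0 < 8 * (coef * C + 1).
  by rewrite mulr_gt0// ltr_pwDr//; apply: mulr_ge0 => //; exact: ltW.
have d0 : 0 < d by rewrite invr_gt0.
pose lam := d `^ (- (b - a)^-1).
have lam0 : 0 < lam by rewrite powR_gt0.
have lamE : lam `^ (- (b - a)) = d.
  by rewrite /lam -powRrM mulrNN mulVf ?gt_eqF// powRr1// ltW.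
exists lam; first exact: ltW.
move=> x y N wx wy N0 xyN s sT; have /andP[s0 sleT] := sT.
rewrite picard_sub// normrM (gtr0_norm c0).
(* In the difference of two sources f(s,0) cancels, so the weight is [l] alone. *)
have [|r r0|r rT|u /andP[u0 _]|_ le] := @abel_norm_bound _ a b hb T C N lam d s (l \_ `[0, T])
   (fun r => source x r - source y r) wC _ _ N0 _ s0 sleT (ltW lam0) (ltW d0) _.
- by apply: measurable_funB; exact: measurable_source.
- by rewrite !source_le0// subrr.
- have /andP[r0 _] := rT; rewrite /source !pospart_gt0//.
  rewrite patchE mem_setE in_itv/= (ltW r0) (_ : r <= T) /=; last by case/andP: rT.
  have l0 := lipschitz_ge0 r0; rewrite (ger0_norm l0) mulrA [leRHS]mulrC.
  by apply: (le_trans (hlip _ _ r0)); rewrite ler_wpM2l// xyN.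
- rewrite -lamE; apply: powR_expRN_le => //; have := ba0; have := a01; have := b1; lra.
apply: (le_trans (ler_wpM2l (ltW c0) le)); rewrite -kern_pos//.
rewrite [leLHS](_ : _ = (8 * (coef * C) * d) * (N / 2 * (kern b s * expR (lam * s)))); last by field.
rewrite ler_piMl ?mulr_ge0 ?kern_ge0 ?expR_ge0 ?invr_ge0//.
by rewrite ler_pdivrMr// mul1r ler_pM2l// lerDl.
Qed.

Lemma picard_cvg0 x : wcont b x -> t `^ (1 - b) * picard x t @[t --> 0^'+] --> x0.
Proof.
move=> wx; have [M M0 hM] := abel_source_bound wx (ltr01 : (0 : R) < 1).
have c0 := coef_gt0; have ba0 : 0 < b - a by rewrite subr_gt0.
apply/cvgrPdist_le => e e0.
have /cvgrPdist_le /(_ (e / (coef * M + 1))) h0 := powR_cvg0 ba0.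
have cM1 : 0 < coef * M + 1 by rewrite ltr_pwDr// mulr_ge0// ltW.
have ecM : 0 < e / (coef * M + 1) by rewrite divr_gt0.
near=> t.
have t0 : 0 < t by near: t; exact: nbhs_right_gt.
have t1 : t <= 1 by apply: ltW; near: t; exact: nbhs_right_lt.
have hta : t `^ (b - a) <= e / (coef * M + 1).
  have : `|0 - t `^ (b - a)| <= e / (coef * M + 1) by near: t; exact: h0.
  by rewrite sub0r normrN ger0_norm ?powR_ge0.
have tb : t `^ (1 - b) * t `^ (b - 1) = 1.
  rewrite -powRD; last by apply/implyP => _; rewrite gt_eqF.
  by rewrite addrC subrKA subrr powRr0.
rewrite /picard mulrDr kern_pos// mulrCA tb mulr1 opprD addrA subrr add0r normrN.
rewrite normrM (ger0_norm (powR_ge0 _ _)) normrM (gtr0_norm c0).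
have tM : `|abel b (source x) t| <= M * (t `^ (b - a) * t `^ (b - 1)).
  by apply: hM; rewrite t0 t1.
apply: (@le_trans _ _ (coef * M * t `^ (b - a))).
  rewrite mulrCA -mulrA ler_wpM2l ?(ltW c0)//.
  apply: (le_trans (ler_wpM2l (powR_ge0 _ _) tM)).
  by rewrite mulrC -2!mulrA [t `^ (b - 1) * _]mulrC tb mulr1.
apply: (@le_trans _ _ ((coef * M + 1) * t `^ (b - a))).
  by rewrite ler_wpM2r ?powR_ge0// lerDl.
by rewrite mulrC -ler_pdivlMr.
Unshelve. all: by end_near. 
Qed.

(** [y] is kept apart from [x] for two uses: a fixed point, where they coincide, and the image
    [picard y] of a solution. The choice of [coef] makes the factor of the integral equal to 1. *)
Lemma RL_integral_picard x y t : wcont b x -> (forall s, 0 < s -> y s = picard x s) ->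
  0 < t -> RL_integral (1 - b) y t =
  (Gamma (1 - b))^-1 * (betaI b * x0) + \int[mu]_(s in `[0, t]) source x s.
Proof.
move=> wx yx t0; have [cx _] := picard_wcont wx.
have cy s : 0 < s -> {for s, continuous y}.
  move=> s0; apply: near_eq_continuous (cx s s0).
  by near=> u; apply: yx; near: u; exact: lt_nbhsr.
rewrite RL_integral_abel//.
have -> : pospart y = fun s => x0 * kern b s + coef * abel b (source x) s.
  apply/funext => s; have [s0|s0] := ltP 0 s; first by rewrite pospart_gt0// yx.
  by rewrite pospart_le0// kern_npos// abel_npos ?mulr0 ?addr0//; exact: source_le0.
rewrite (weighted_abel_comp hb ab (measurable_source wx) (source_le0 x)
  (source_weighted wx) (continuous_source wx))//.
have G0 : Gamma (1 - b) != 0 by rewrite gt_eqF// Gamma_gt0.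
have B0 : betaI b != 0 by rewrite gt_eqF// betaI_gt0.
by rewrite /coef; field; rewrite G0 B0.
Unshelve. all: by end_near. Qed.

Lemma integral_source_derive x (t : R) : wcont b x -> 0 < t ->
  is_derive t 1 (fun t => \int[mu]_(s in `[0, t]) source x s) (f t (x t)).
Proof.
move=> wx t0; have tt1 : t < t + 1 by rewrite ltrDl.
have ih : mu.-integrable `[0, t + 1] (EFin \o source x).
  exact: (weighted_integrable_itv ab (measurable_source wx) (source_le0 x)
    (source_weighted wx)).
have [dH H'] := continuous_FTC1_closed tt1 ih t0 (continuous_source wx t0).
by apply: DeriveDef => //; rewrite -derive1E H' /source pospart_gt0.
Qed.

Lemma absolutely_continuous_source x T : wcont b x ->
  absolutely_continuous 0 T (fun t => \int[mu]_(s in `[0, t]) source x s).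
Proof.
move=> wx; apply: absolutely_continuous_integral.
exact: (weighted_integrable_itv ab (measurable_source wx) (source_le0 x)
    (source_weighted wx)).
Qed.

(** The source is continuous on the positive axis, so the equation holds at every t > 0. The witness
    of absolute continuity is a constant plus the integral of the source, and it need not match
    [RL_integral] at 0. *)
Lemma fixpoint_solution x : wcont b x -> (forall t, 0 < t -> x t = picard x t) ->
  is_solution b x0 f x.
Proof.
move=> wx xfix.
have lim0 : t `^ (1 - b) * x t @[t --> 0^'+] --> x0.
  apply: cvg_trans (picard_cvg0 wx); apply: near_eq_cvg; near=> t.
  by rewrite [in RHS]xfix//; near: t; exact: nbhs_right_gt.
split=> //.
- split; last by exists x0.
  by apply/within_itvoy_continuous; case: wx.
- move=> T T0; exists (fun t => (Gamma (1 - b))^-1 * (betaI b * x0) +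
      \int[mu]_(s in `[0, t]) source x s).
    move=> e e0; have [d d0 hd] := absolutely_continuous_source T wx e0.
    exists d => // n u v uv tr sd; apply: le_lt_trans (hd n u v uv tr sd).
    by apply: ler_sum => i _; rewrite opprD addrACA subrr add0r.
  by move=> t /andP[t0 _]; exact: RL_integral_picard.
- move=> T T0; apply: aeW => t /andP[t0 _].
  have RLnear : \forall s \near t, (Gamma (1 - b))^-1 * (betaI b * x0) +
      \int[mu]_(r in `[0, s]) source x r = RL_integral (1 - b) x s.
    near=> s; apply/esym/RL_integral_picard => //; near: s; exact: lt_nbhsr.
  have dH := integral_source_derive wx t0.
  have dKH : is_derive t 1 (fun s => (Gamma (1 - b))^-1 * (betaI b * x0) +
      \int[mu]_(r in `[0, s]) source x r) (f t (x t)).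
    by rewrite -[X in is_derive _ _ _ X]add0r; exact: is_deriveD.
  have [dRL RLE] := near_eq_is_derive RLnear dKH.
  by split; [exact: dRL|rewrite /RL_derivative derive1E; exact: RLE].
Unshelve. all: by end_near. Qed.

(** * From a solution back to the Volterra equation *)

Lemma solution_wcont y : is_solution b x0 f y -> wcont b y.
Proof.
move=> [[/within_itvoy_continuous cy _] _ _ y0]; split=> // T T0.
move/cvgrPdist_lt : y0 => /(_ 1 ltr01); rewrite near_withinE => -[r /= r0 hr].
have tb t : 0 < t -> t `^ (1 - b) * t `^ (b - 1) = 1.
  move=> t0; rewrite -powRD; last by apply/implyP => _; rewrite gt_eqF.
  by rewrite addrC subrKA subrr powRr0.
pose z t := t `^ (1 - b) * y t.
have yz t : 0 < t -> `|y t| = `|z t| * kern b t.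
  move=> t0; rewrite kern_pos// /z normrM mulrAC (ger0_norm (powR_ge0 _ _)) tb//.
  by rewrite mul1r.
have near0 t : 0 < t -> t < r -> `|z t| <= `|x0| + 1.
  move=> t0 tr; have := hr t; rewrite /ball_/= sub0r normrN gtr0_norm// => /(_ tr t0) zt.
  rewrite -[z t](subKr x0) (le_trans (ler_normB _ _))// lerD2l; exact: ltW.
(* The limit at 0 controls [z] below [r]; from there on compactness takes over, the added [T]
   ensuring that the interval is nonempty and contains [[r, T]]. *)
have [||c _ cmax] := @EVT_max _ (fun t => `|z t|) (r / 2) (r / 2 + T).
- by rewrite lerDl ltW.
- apply: continuous_in_subspaceT => t; rewrite inE/= in_itv/= => /andP[rt _].
  have t0 : 0 < t by apply: lt_le_trans rt; rewrite divr_gt0.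
  apply: cvg_norm; apply: (@continuousM _ _ (fun t => t `^ (1 - b)) y); last exact: cy.
  apply: differentiable_continuous; apply/derivable1_diffP.
  by apply: derivable_powR; rewrite in_itv/= t0.
exists (`|x0| + 1 + `|z c|); first by rewrite !addr_ge0.
move=> s /andP[s0 sT]; rewrite yz// ler_wpM2r ?kern_ge0//.
have [sr|rs] := ltP s r; first by rewrite (le_trans (near0 s s0 sr))// lerDl.
apply: (@le_trans _ _ `|z c|); last by rewrite lerDr addr_ge0.
apply: cmax; rewrite in_itv/=; apply/andP; split; lra.
Qed.

Lemma wcontB x y : wcont b x -> wcont b y -> wcont b (fun t => x t - y t).
Proof.
move=> [cx xM] [cy yM]; split=> [s s0|T T0].
  by apply: continuousB; [exact: cx|exact: cy].
have [M1 M10 hM1] := xM T T0; have [M2 M20 hM2] := yM T T0.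
exists (M1 + M2); first exact: addr_ge0.
move=> s sT; apply: (le_trans (ler_normB _ _)); rewrite mulrDl.
by apply: lerD; [exact: hM1|exact: hM2].
Qed.

(** By scale invariance of the Beta integral the bound is independent of [t], so a function that is
    o(t^(b-1)) at 0 has an Abel integral tending to 0. *)
Lemma wcont_abel z M t : wcont b z -> 0 <= M -> 0 < t ->
  (forall s, 0 < s <= t -> `|z s| <= M * kern b s) ->
  mu.-integrable [set: R] (EFin \o (fun s => kern (1 - b) (t - s) * pospart z s)) /\
  `|abel (1 - b) (pospart z) t| <= M * betaI b.
Proof.
move=> [cz _] M0 t0 hM; have mz := measurable_pospart cz.
have mk : measurable_fun [set: R] (fun s => kern (1 - b) (t - s) * pospart z s).
  by apply: measurable_funM => //; exact: measurable_kern_refl.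
apply: norm_Rintegral_le => //.
rewrite EFinM -(beta_scale hb t0) -ge0_integralZl//; last 2 first.
- by apply/measurable_EFinP; exact: measurable_beta_integrand.
- by move=> s _; rewrite lee_fin mulr_ge0 ?kern_ge0.
apply: ge0_le_integral => //.
- by apply/measurable_EFinP/measurableT_comp.
- apply: measurable_funeM; apply/measurable_EFinP; exact: measurable_beta_integrand.
- move=> s _; rewrite -EFinM lee_fin normrM (ger0_norm (kern_ge0 _ _)).
  have rhs0 : 0 <= M * (kern (1 - b) (t - s) * kern b s).
    by rewrite !mulr_ge0 ?kern_ge0.
  have [s0|s0] := leP s 0; first by rewrite pospart_le0// normr0 mulr0.
  have [ts|st] := leP t s.
    by rewrite (@kern_npos _ _ (t - s)) ?subr_le0// !mul0r mulr0.
  by rewrite pospart_gt0// mulrCA ler_wpM2l ?kern_ge0// hM// s0 ltW.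
Qed.

Lemma wcont_integrable_itv z T : wcont b z ->
  mu.-integrable `[0, T] (EFin \o pospart z).
Proof.
move=> [cz zM]; have mz := measurable_pospart cz.
have [T0|T0] := ltP 0 T; last first.
  have : mu.-integrable `[0, T] (EFin \o cst (0 : R)) by exact: integrable0.
  apply: eq_integrable => // s; rewrite inE/= in_itv/= => /andP[_ sT].
  by rewrite pospart_le0// (le_trans sT).
have [M M0 hM] := zM T T0.
have := integrable_scale M (measurable_itv `[0, T]) (integrable_kern_itv T b0).
apply: le_integrable => //.
  by apply/measurable_EFinP; exact: measurable_funTS.
move=> s /=; rewrite in_itv/= => /andP[s0 sT]; rewrite lee_fin.
rewrite [leRHS]ger0_norm ?mulr_ge0 ?kern_ge0//.
move: s0; rewrite le_eqVlt => /predU1P[s0|s0].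
  by rewrite pospart_le0 ?normr0 ?mulr_ge0 ?kern_ge0// -s0.
by rewrite pospart_gt0// hM// s0.
Qed.

(** A further Abel integration of order [b] turns the hypothesis into the vanishing of every
    integral of [z] from 0, by [abel_comp] with the roles of b and 1-b exchanged; continuity then
    gives z = 0. *)
Lemma wcont_abel_inj z : wcont b z ->
  (forall t, 0 < t -> abel (1 - b) (pospart z) t = 0) ->
  forall t, 0 < t -> z t = 0.
Proof.
move=> wz az t t0; have [cz zM] := wz; rewrite -pospart_gt0//.
have ikz u : mu.-integrable [set: R]
    (EFin \o (fun s => kern (1 - b) (u - s) * pospart z s)).
  have [u0|u0] := ltP 0 u.
    have [M M0 hM] := zM u u0.
    by have [] := wcont_abel wz M0 u0 hM.
  rewrite (_ : (fun s => _) = cst 0); first exact: integrable0.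
  apply/funext => s; have [s0|s0] := leP s 0; first by rewrite pospart_le0// mulr0.
  by rewrite kern_npos ?mul0r//; lra.
have az0 : abel (1 - b) (pospart z) = cst 0.
  apply/funext => u; have [u0|u0] := ltP 0 u; first exact: az.
  by apply: abel_npos => // s; exact: pospart_le0.
apply: integral0_continuous_eq0 => //.
- by move=> T; exact: wcont_integrable_itv.
- move=> u u0; apply/eqP.
  have := @abel_comp _ (1 - b) (pospart z) u hb' (measurable_pospart cz)
    (@pospart_le0 _ z) (wcont_integrable_itv u wz) ikz.
  rewrite az0 /abel; under eq_Rintegral do rewrite mulr0.
  rewrite Rintegral_cst// mul0r => /esym/eqP; rewrite mulf_eq0 => /orP[|//].
  by have := betaI_ge1 hb'; rewrite le_eqVlt => /predU1P[<-|/(lt_trans ltr01)/gt_eqF->//];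
    rewrite oner_eq0.
- exact: continuous_pospart (cz t t0).
Qed.

(** The interval starts at s > 0 because the absolutely continuous extension agrees with
    [RL_integral] only away from 0. On it both terms are absolutely continuous, with the same
    derivative almost everywhere. *)
Lemma solution_increment y : is_solution b x0 f y -> forall s t, 0 < s -> s < t ->
  RL_integral (1 - b) y t - \int[mu]_(r in `[0, t]) source y r =
  RL_integral (1 - b) y s - \int[mu]_(r in `[0, s]) source y r.
Proof.
move=> soly s t s0 st; have wy := solution_wcont soly; have [_ acy dy _] := soly.
have t0 := lt_trans s0 st.
pose F := RL_integral (1 - b) y; pose H u := \int[mu]_(r in `[0, u]) source y r.
apply: (absolutely_continuous_derive0 (D := fun u => F u - H u) st).
  have [G acG FG] := acy t t0; move=> e e0; have e20 : 0 < e / 2 by rewrite divr_gt0.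
  have [d1 d10 hd1] := acG _ e20.
  have [d2 d20 hd2] := absolutely_continuous_source t wy e20.
  exists (Num.min d1 d2); first by rewrite lt_min d10.
  move=> n u v uv tr; rewrite lt_min => /andP[sd1 sd2].
  have uv0 i : [/\ 0 <= u i, u i < v i & v i <= t].
    by have [su uvi vt] := uv i; split => //; rewrite (le_trans (ltW s0)).
  have h1 := hd1 n u v uv0 tr sd1; have h2 := hd2 n u v uv0 tr sd2.
  rewrite (splitr e); apply: le_lt_trans (ltrD h1 h2).
  rewrite -big_split; apply: ler_sum => i _ /=; have [su uvi vt] := uv i.
  have u0 := lt_le_trans s0 su; have v0 := lt_trans u0 uvi.
  have Fv : F (v i) = G (v i) by apply: FG; rewrite v0.
  have Fu : F (u i) = G (u i) by apply: FG; rewrite u0 (le_trans (ltW uvi)).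
  rewrite Fv Fu; have tri (c1 c2 c3 c4 : R) :
      `|c1 - c2 - (c3 - c4)| <= `|c1 - c3| + `|c2 - c4|.
    rewrite (_ : c1 - c2 - (c3 - c4) = (c1 - c3) - (c2 - c4)); last by ring.
    exact: ler_normB.
  exact: tri.
have := dy t t0; apply: filterS; first exact: (ae_filter_ringOfSetsType mu).
move=> u hu /andP[su ut].
have u0 := lt_le_trans s0 su.
have [|dF F'] := hu; first by rewrite u0.
have dF' : is_derive u 1 F (f u (y u)).
  by apply: DeriveDef; [exact: dF|rewrite -derive1E; exact: F'].
have dH := integral_source_derive wy u0.
by rewrite -(subrr (f u (y u))); exact: is_deriveB.
Qed.

(** For z = y - [picard y], the fractional integral of the second term is known from
    [RL_integral_picard], so [solution_increment] makes [K] constant; smallness at 0 gives K = 0,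
    and injectivity of the Abel integral gives z = 0. *)
Lemma solution_fixpoint y : is_solution b x0 f y -> forall t, 0 < t -> y t = picard y t.
Proof.
move=> soly; have wy := solution_wcont soly; have wp := picard_wcont wy.
have wz := wcontB wy wp; have [_ _ _ y0] := soly.
pose z t := y t - picard y t.
have G0 : Gamma (1 - b) != 0 by rewrite gt_eqF// Gamma_gt0.
pose K t := abel (1 - b) (pospart z) t.
have Kconst s t : 0 < s -> s < t -> K t = K s.
  have KE r : 0 < r -> K r = Gamma (1 - b) * (RL_integral (1 - b) y r -
      \int[mu]_(v in `[0, r]) source y v) - betaI b * x0.
    move=> r0; have [cy yM] := wy; have [cp pM] := wp.
    have [M1 M10 hM1] := yM r r0; have [M2 M20 hM2] := pM r r0.
    have [iy _] := wcont_abel wy M10 r0 hM1; have [ip _] := wcont_abel wp M20 r0 hM2.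
    have E : K r = abel (1 - b) (pospart y) r - abel (1 - b) (pospart (picard y)) r.
      rewrite /K /abel -RintegralB//; apply: eq_Rintegral => v _; rewrite -mulrBr.
      congr (_ * _); have [v0|v0] := ltP 0 v; first by rewrite !pospart_gt0.
      by rewrite !pospart_le0// subrr.
    have := RL_integral_picard wy (fun s _ => erefl (picard y s)) r0.
    rewrite E !RL_integral_abel// => W.
    have -> : abel (1 - b) (pospart (picard y)) r =
        Gamma (1 - b) * ((Gamma (1 - b))^-1 * abel (1 - b) (pospart (picard y)) r).
      by rewrite mulVKf.
    by rewrite W; field.
  move=> s0 st; rewrite !KE ?(lt_trans s0 st)//; congr (_ * _ - _).
  exact: solution_increment.
(* Near 0, |z| is at most (e / [betaI b]) times [kern b], since both weighted limits equal [x0].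
   Hence |K s| <= e for a small [s], and constancy transports this to [t]. *)
have K0 t : 0 < t -> K t = 0.
  move=> t0; apply/eqP; rewrite -normr_le0; apply/ler_addgt0Pr => e e0; rewrite add0r.
  have B0 := betaI_gt0; have eB : 0 < e / betaI b by rewrite divr_gt0.
  have z0 : s `^ (1 - b) * y s - s `^ (1 - b) * picard y s @[s --> 0^'+] --> x0 - x0.
    by apply: cvgB; [exact: y0|exact: picard_cvg0].
  rewrite subrr in z0; move/cvgrPdist_lt : z0 => /(_ _ eB); rewrite near_withinE => -[r /= r0 hr].
  pose s := Num.min (t / 2) (r / 2).
  have s0 : 0 < s by rewrite lt_min !divr_gt0.
  have sr : s < r by rewrite gt_min; apply/orP; right; lra.
  have st : s < t by rewrite gt_min; apply/orP; left; lra.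
  rewrite (Kconst s t s0 st); have [|_] := wcont_abel wz (ltW eB) s0.
    move=> u /andP[u0 us]; have := hr u; rewrite /ball_/= sub0r normrN gtr0_norm//.
    move=> /(_ (le_lt_trans us sr) u0); rewrite sub0r normrN -mulrBr normrM.
    rewrite (ger0_norm (powR_ge0 _ _)) => /ltW hu.
    rewrite kern_pos// (_ : b - 1 = - (1 - b)); last by ring.
    by rewrite powRN ler_pdivlMr ?powR_gt0// mulrC.
  by rewrite divfK// gt_eqF.
by move=> t t0; apply/eqP; rewrite -subr_eq0; apply/eqP; exact: (wcont_abel_inj wz K0).
Qed.

End Problem.

Theorem theorem3p10 (R : realType) (b x0 p q : R) (f : R -> R -> R) (l : R -> R)
    (hb : 0 < b < 1) (hp : b^-1 < p) (hq : q = p / (p - 1))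
    (hf : {within [set tx : R * R | 0 < tx.1],
             continuous (fun tx : R * R => f tx.1 tx.2)})
    (hlip : forall t x y : R, 0 < t -> `|f t x - f t y| <= l t * `|x - y|)
    (hlC : {within `]0, +oo[, continuous l})
    (hlp : Lp_loc p l)
    (hf0 : Lp_loc p (fun t => t `^ (1 - b) * `|f t 0|)) :
  exists x : R -> R, is_solution b x0 f x /\
    forall y : R -> R, is_solution b x0 f y -> forall t : R, 0 < t -> y t = x t.
Proof.
have contr := picard_contract x0 hb hp hf hlip hlp hf0.
have [x wx xfix] := fixpoint_exists (picard_wcont x0 hb hp hf hlip hlp hf0) contr
  (wcont_kern b x0) hb.
exists x; split; first exact: (fixpoint_solution hb hp hf hlip hlp hf0 wx xfix).
move=> y soly; have wy := solution_wcont soly.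
have yfix := solution_fixpoint hb hp hf hlip hlp hf0 soly.
exact: (fixpoint_unique contr wy wx yfix xfix).
Qed.
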